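(* Let $k$ be a field of characteristic different from $2$ and $3$ containing a primitive third root of unity $\omega$. Then the Ueno-type manifold $X_{4,6}$ is unirational over $k$, i.e. there is a dominant rational map $\mathbb{P}^4_k \dashrightarrow X_{4,6}$ defined over $k$.
   Context: Let $E(6) := \{(x:y:z) \mid y^2 z = x^3 - z^3\} \subset \mathbb{P}^2_k$ (the equianharmonic elliptic curve), with the automorphism $g_6(x:y:z) = (\omega x : -y : z)$ of order $6$. Let $g_6$ act diagonally on the product $E(6)^4 = E(6)\times E(6)\times E(6)\times E(6)$ and let $Y_{4,6} := E(6)^4/\langle g_6\rangle$. This is a normal projective variety over $k$ with finitely many singular points, all $k$-rational, each a cyclic quotient singularity of type $(1,1,1,1)/6$, $(1,1,1,1)/3$ or $(1,1,1,1)/2$. The Ueno-type manifold $X_{4,6}$ is the minimal resolution of singularities of $Y_{4,6}$, obtained by blowing up $Y_{4,6}$ at the maximal ideals of its singular points; it is a smooth projective fourfold over $k$. *)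

(* Defs.v *)
From HB Require Import structures.
From mathcomp Require Import all_boot all_order all_algebra fraction.
From mathcomp Require Import boolp classical_sets.
From mathcomp Require Import mpoly.

Set Implicit Arguments.
Unset Strict Implicit.
Unset Printing Implicit Defensive.

Import GRing.Theory.

Local Open Scope ring_scope.
Local Open Scope classical_set_scope.

(* Integral separated schemes of finite type over a field k are described as  *)
(* in Chevalley's "schemata" (EGA I, section 8): such a scheme is determined  *)
(* by its function field K and by the set of its local rings, regarded as     *)
(* subrings of K.  A point (of the scheme, not necessarily closed or          *)
(* rational) IS its local ring, hence has type [set K], and a scheme is a set *)
(* of such subrings; the generic point is K itself.                           *)

Section LocalRings.
Variable K : fieldType.
Implicit Types (A O p S F : set K) (X U : set (set K)).

Definition is_subring A : Prop :=
  [/\ A 1, forall a b, A a -> A b -> A (a - b)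
    & forall a b, A a -> A b -> A (a * b)].

Definition gen_ring S : set K := smallest is_subring S.

Definition is_prime A p : Prop :=
  [/\ p `<=` A,
      p 0 /\ (forall a b, p a -> p b -> p (a + b)),
      forall a b, A a -> p b -> p (a * b),
      ~ p 1
    & forall a b, A a -> A b -> p (a * b) -> p a \/ p b].

Definition localization A p : set K :=
  [set f | exists a s, [/\ A a, A s, ~ p s & f = a / s]].

Definition spec A : set (set K) :=
  [set O | exists2 p, is_prime A p & O = localization A p].

(* The non-units of O; when O is local this is its maximal ideal.  The case   *)
(* f = 0 is separate because 0^-1 = 0 in MathComp.                            *)
Definition max_ideal O : set K := [set f | O f /\ (f = 0 \/ ~ O f^-1)].

Definition krull_dim_ge O (d : nat) : Prop :=
  exists p : 'I_d.+1 -> set K,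
    (forall i, is_prime O (p i)) /\
    (forall i j : 'I_d.+1, (i < j)%N -> p i `<` p j).

Definition max_ideal_generated_by O (d : nat) : Prop :=
  exists s : 'I_d -> K,
    (forall i, max_ideal O (s i)) /\
    (forall f, max_ideal O f -> exists2 c : 'I_d -> K,
       (forall i, O (c i)) & f = \sum_i c i * s i).

(* A Noetherian local ring is regular when its maximal ideal can be generated *)
(* by at most dim O elements.                                                 *)
Definition regular O : Prop :=
  exists d, krull_dim_ge O d /\ max_ideal_generated_by O d.

(* The sets of points of X at which finitely many given rational functions    *)
(* are regular form a basis of the Zariski topology of X (for an affine       *)
(* chart: F a finite set of generators of its coordinate ring; for a          *)
(* principal open subset of the chart: add 1/h to F).                         *)
Definition zariski_open X U : Prop :=
  U `<=` X /\
  forall O, U O -> exists F : seq K,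
    (forall f, f \in F -> O f) /\
    (forall Q, X Q -> (forall f, f \in F -> Q f) -> U Q).

Definition singular_locus X : set (set K) := [set O | X O /\ ~ regular O].

(* Blow-up of X at a set Z of closed points, each with its maximal ideal m:   *)
(* near P in Z it is covered by the affine charts Spec P[m/f], f in m \ {0}.  *)
(* The points of such a chart not lying over P are points of X \ Z.           *)
Definition blowup_points X (Z : set (set K)) : set (set K) :=
  [set O | (X O /\ ~ Z O) \/
     exists P f, [/\ Z P, max_ideal P f, f != 0
       & spec (gen_ring (P `|` [set h / f | h in max_ideal P])) O]].

End LocalRings.

Record schema (k : fieldType) := Schema {
  funfield : fieldType;
  const : {rmorphism k -> funfield};
  points : set (set funfield)
}.
Arguments const {k} s.
Arguments points {k} s.

(* The closed subvariety of a product, indexed by I, of projective spaces     *)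
(* P^J over k whose generic point has homogeneous coordinates                 *)
(* (h i j)_(j : J) in the factor i: for every choice c of one homogeneous     *)
(* coordinate in each factor there is an affine chart with coordinate ring    *)
(* k[h i j / h i (c i) : i, j].                                               *)
Definition multiproj (k K : fieldType) (iota : {rmorphism k -> K})
    (I J : Type) (h : I -> J -> K) : schema k :=
  Schema iota
    [set O | exists2 c : I -> J, (forall i, h i (c i) != 0)
       & spec (gen_ring (range iota `|`
           [set f | exists i j, f = h i j / h i (c i)])) O].

Definition proj_space (k : fieldType) (n : nat) : schema k :=
  multiproj (@tofrac _ \o @mpolyC n k : {rmorphism k -> {fraction {mpoly k[n]}}})
    (fun (_ : unit) (j : 'I_n.+1) =>
       if unlift ord0 j is Some i then @tofrac {mpoly k[n]} 'X_i else 1).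

Definition blowup (k : fieldType) (X : schema k)
    (Z : set (set (funfield X))) : schema k :=
  Schema (const X) (blowup_points (points X) Z).

(* A dominant rational map X --> Z is a k-embedding phi of function fields    *)
(* (its comorphism) for which there is a nonempty open U in X such that each  *)
(* point O of U has an image Q in Z, i.e. phi induces a local homomorphism    *)
(* from the local ring Q to the local ring O.                                 *)
Definition dominant_rational_map (k : fieldType) (X Z : schema k)
    (phi : {rmorphism funfield Z -> funfield X}) : Prop :=
  (forall c, phi (const Z c) = const X c) /\
  exists U, [/\ zariski_open (points X) U, U !=set0
    & forall O, U O -> exists Q, [/\ points Z Q,
        (forall f, Q f -> O (phi f))
      & (forall f, max_ideal Q f -> max_ideal O (phi f))]].

Definition unirational_from (k : fieldType) (n : nat) (X : schema k) : Prop :=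
  exists phi, @dominant_rational_map k (proj_space k n) X phi.

Section FixedField.
Variables (K : fieldType) (g : {rmorphism K -> K}).

Definition fixed : {pred K} := [pred f | g f == f].

Fact fixed_divring_closed : divring_closed fixed.
Proof.
split=> [|a b /eqP ga /eqP gb|a b /eqP ga /eqP gb].
- by rewrite inE rmorph1.
- by rewrite inE rmorphB ga gb.
- by rewrite inE fmorph_div ga gb.
Qed.
HB.instance Definition _ := GRing.isDivringClosed.Build K fixed
  fixed_divring_closed.

Record fixed_field := FixedField {
  fixed_val :> K;
  fixed_valP : fixed_val \in fixed
}.
HB.instance Definition _ := [isSub for fixed_val].
HB.instance Definition _ := [Choice of fixed_field by <:].
HB.instance Definition _ := [SubChoice_isSubIntegralDomain of fixed_field by <:].
HB.instance Definition _ := [SubIntegralDomain_isSubField of fixed_field by <:].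

Variables (k : fieldType) (iota : {rmorphism k -> K}).
Hypothesis g_iota : forall c, g (iota c) = iota c.

Fact fixed_constP c : iota c \in fixed.
Proof. by rewrite inE g_iota. Qed.

Definition fixed_const (c : k) : fixed_field := FixedField (fixed_constP c).

Fact fixed_const_is_zmod_morphism : zmod_morphism fixed_const.
Proof. by move=> a b; apply/val_inj; rewrite /= rmorphB. Qed.
Fact fixed_const_is_monoid_morphism : monoid_morphism fixed_const.
Proof. by split=> [|a b]; apply/val_inj; rewrite /= (rmorph1, rmorphM). Qed.
HB.instance Definition _ := GRing.isZmodMorphism.Build k fixed_field
  fixed_const fixed_const_is_zmod_morphism.
HB.instance Definition _ := GRing.isMonoidMorphism.Build k fixed_field
  fixed_const fixed_const_is_monoid_morphism.

End FixedField.

(* Quotient of X by the finite group generated by an automorphism over k,     *)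
(* with comorphism g on the function field: the function field is the fixed   *)
(* field of g, and the local ring at the orbit of a point O consists of the   *)
(* invariant functions that are regular at O (equivalently, at every point of *)
(* the orbit of O).                                                           *)
Definition cyclic_quotient (k : fieldType) (X : schema k)
    (g : {rmorphism funfield X -> funfield X})
    (gk : forall c, g (const X c) = const X c) : schema k :=
  Schema (fixed_const gk : {rmorphism k -> fixed_field g})
    [set [set f : fixed_field g | O (fixed_val f)] | O in points X].

(* A function field of E(6)^n over k, where E(6) : y^2 z = x^3 - z^3, together *)
(* with the affine coordinate functions (x_i : y_i : 1) of the n factors: the  *)
(* coordinate ring of the affine chart (z <> 0)^n of E(6)^n is                 *)
(* k[X_i, Y_i] / (Y_i^2 - X_i^3 + 1), it embeds in K, and K is its fraction    *)
(* field.  This determines (K, x, y) up to a unique isomorphism over k.        *)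
Definition E6_eval (k K : fieldType) (iota : {rmorphism k -> K}) (n : nat)
    (x y : 'I_n -> K) (p : {mpoly k[n + n]}) : K :=
  mmap iota (fun j => match split j with inl i => x i | inr i => y i end) p.

Record E6_power_field (k : fieldType) (n : nat) := E6PowerField {
  E6_field :> fieldType;
  E6_const : {rmorphism k -> E6_field};
  E6_x : 'I_n -> E6_field;
  E6_y : 'I_n -> E6_field;
  E6_relations : forall p : {mpoly k[n + n]},
    E6_eval E6_const E6_x E6_y p = 0 <->
    exists q : 'I_n -> {mpoly k[n + n]},
      p = \sum_i q i * ('X_(rshift n i) ^+ 2 - 'X_(lshift n i) ^+ 3 + 1);
  E6_fractions : forall f : E6_field, exists p q : {mpoly k[n + n]},
    E6_eval E6_const E6_x E6_y q != 0 /\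
    f = E6_eval E6_const E6_x E6_y p / E6_eval E6_const E6_x E6_y q
}.

Definition E6_power (k : fieldType) (n : nat) (K : E6_power_field k n) :
    schema k :=
  multiproj (E6_const K) (fun (i : 'I_n) (j : 'I_3) =>
    nth 0 [:: E6_x K i; E6_y K i; 1] j).

(* Comorphism, over k, of the diagonal automorphism of E(6)^n acting by       *)
(* (x : y : z) |-> (w x : - y : z) on each factor.                            *)
Record is_g6 (k : fieldType) (n : nat) (w : k) (K : E6_power_field k n)
    (g : {rmorphism K -> K}) : Prop := IsG6 {
  g6_const : forall c, g (E6_const K c) = E6_const K c;
  g6_x : forall i, g (E6_x K i) = E6_const K w * E6_x K i;
  g6_y : forall i, g (E6_y K i) = - E6_y K i
}.

Definition Y6 (k : fieldType) (n : nat) (w : k) (K : E6_power_field k n)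
    (g : {rmorphism K -> K}) (hg : is_g6 w g) : schema k :=
  @cyclic_quotient k (E6_power K) g (g6_const hg).

Definition X6 (k : fieldType) (n : nat) (w : k) (K : E6_power_field k n)
    (g : {rmorphism K -> K}) (hg : is_g6 w g) : schema k :=
  @blowup k (Y6 hg) (singular_locus (points (Y6 hg))).

(* Main.v *)
(** Put [theta = w^2 - w].  Four points [(x_i, y_i)], [i = 0..3], on a curve
    [y^2 = x^3 + D] are studied through the slopes
    [m_j = (y_j + y_0) / (x_j - x_0)], [m'_j = (y_j - y_0) / (x_j - w x_0)],
    for which [m_j m'_j = x_j - w^2 x_0].  In terms of
    [alpha_j = m_j + w^2 m'_j] and [beta_j = m_j + w m'_j] the point
    [(x_0, y_0)] satisfies
    [2 y_0 = (alpha_j^3 - beta_j^3) / (3 theta) + (w^2 - 1) x_0 alpha_j]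
    for [j = 1, 2, 3].  Eliminating [y_0] and [x_0] leaves
    [sum_j d_j alpha_j^3 = sum_j d_j beta_j^3] with [d_j = alpha_(j+1) - alpha_(j+2)],
    and the left-hand side is [- d_1 d_2 d_3 (alpha_1 + alpha_2 + alpha_3)].  This
    is linear in the sum of the [alpha_j], so all the coordinates are rational
    functions of the differences [d_j] and of the [beta_j].  The latter have
    weight one for the scaling of the twists [D], hence for [g6], and their
    ratios are four free generators of the function field of [E(6)^4 / g6]:
    the quotient is even rational over [k].

    On a principal open set [Spec B] of the affine space with these coordinates
    the covering is [B[e]] with [e^6] a unit, so every local ring of [B] is the
    ring of invariants of a local ring of [E(6)^4]; it is regular as a
    localization of a polynomial ring, hence a point of the blow-up too. *)

Require Import Defs.
From HB Require Import structures.
From mathcomp Require Import all_boot all_order all_algebra fraction.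
From mathcomp Require Import boolp classical_sets.
From mathcomp Require Import mpoly ring.

Set Implicit Arguments.
Unset Strict Implicit.
Unset Printing Implicit Defensive.

Import GRing.Theory.

Local Open Scope ring_scope.
Local Open Scope classical_set_scope.

(** * Regularity of polynomial rings *)

Section RegularRings.

Definition prime_set (R : comNzRingType) (P : set R) : Prop :=
  [/\ P 0, forall a b, P a -> P b -> P (a + b), forall a b, P b -> P (a * b),
      ~ P 1 & forall a b, P (a * b) -> P a \/ P b].

(** This is regularity of the local ring at [P], with denominators cleared: a chain of primes below
    [P], and generators of [P] up to a multiplier outside [P]. No ring of fractions is formed, which
    keeps the induction on the number of variables inside polynomial rings. *)
Definition regular_at (R : comNzRingType) (P : set R) : Prop :=
  exists d : nat,
    (exists c : nat -> set R,
       (forall i, (i <= d)%N -> prime_set (c i) /\ c i `<=` P) /\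
       (forall i j, (i < j <= d)%N -> c i `<` c j)) /\
    (exists s : 'I_d -> R, (forall i, P (s i)) /\
       forall a, P a -> exists u x, ~ P u /\ u * a = \sum_i x i * s i).

Definition regular_ring (R : comNzRingType) : Prop :=
  forall P : set R, prime_set P -> regular_at P.

Section PrimeSets.
Variables (R : comNzRingType) (P : set R).
Hypothesis primeP : prime_set P.

Lemma prime_set_nM a b : ~ P a -> ~ P b -> ~ P (a * b).
Proof. by case: primeP => _ _ _ _ PM nPa nPb /PM[]. Qed.

Lemma prime_setN a : P a -> P (- a).
Proof. by case: primeP => _ _ PM _ _ Pa; rewrite -mulN1r; apply: PM. Qed.

Lemma prime_setB a b : P a -> P b -> P (a - b).
Proof.
by case: (primeP) => _ PD _ _ _ Pa Pb; apply: PD => //; apply: prime_setN.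
Qed.

Lemma prime_set_sum (I : Type) (r : seq I) (Q : pred I) (F : I -> R) :
  (forall i, Q i -> P (F i)) -> P (\sum_(i <- r | Q i) F i).
Proof. by case: primeP => P0 PD _ _ _; apply: big_ind. Qed.

End PrimeSets.

Lemma prime_set_preim (R S : comNzRingType) (f : {rmorphism R -> S})
    (P : set S) : prime_set P -> prime_set (f @^-1` P).
Proof.
case=> P0 PD PM P1 PP; split=> [|a b|a b||a b]; rewrite /preimage /=.
- by rewrite rmorph0.
- by rewrite rmorphD; apply: PD.
- by rewrite rmorphM; apply: PM.
- by rewrite rmorph1.
- by rewrite rmorphM; apply: PP.
Qed.

Lemma regular_ring_iso (R S : comNzRingType) (f : {rmorphism R -> S})
    (g : {rmorphism S -> R}) :
  cancel f g -> cancel g f -> regular_ring S -> regular_ring R.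
Proof.
move=> fK gK regS P primeP.
have [d [[c [c_prime c_lt]] [s [Ps s_gen]]]] := regS _ (prime_set_preim g primeP).
exists d; split.
  exists (fun i => f @^-1` c i); split=> [i /c_prime[ci ciP]|i j /c_lt].
    split; first exact: prime_set_preim.
    by move=> a /ciP; rewrite /preimage /= fK.
  move=> [sub nsub]; split=> [a|sub']; first exact: sub.
  by apply: nsub => b cb; rewrite -[b]gK; apply: sub'; rewrite /preimage /= gK.
exists (g \o s); split=> // a Pa.
have [|u [x [Pu ux]]] := s_gen (f a); first by rewrite /preimage /= fK.
exists (g u), (g \o x); split=> //; rewrite -[a in LHS]fK -rmorphM ux rmorph_sum.
by apply: eq_bigr => i _; rewrite rmorphM.
Qed.

Lemma regular_field (k : fieldType) : regular_ring k.
Proof.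
move=> P primeP; have [P0 PD PM P1 PP] := primeP.
have P_eq0 a : P a -> a = 0.
  move=> Pa; apply: contra_notP P1 => /eqP a0.
  by rewrite -(mulVf a0); apply: PM.
exists 0%N; split.
  exists (fun=> P); split=> [i _|i j]; first by split.
  by rewrite leqn0 andbC => /andP[/eqP->].
exists (fun=> 0); split=> [[]|a /P_eq0 ->]; first by [].
by exists 1, (fun=> 0); split=> //; rewrite mulr0 big_ord0.
Qed.

(** * Extension of primes from [R] to [{poly R}] *)

Section Extension.
Variable R : comNzRingType.
Implicit Types (P : set R) (f g : {poly R}).

Definition poly_ext P : set {poly R} := [set f | forall i, P f`_i].

(** As in Gauss's lemma: if [i] and [j] are the lowest indices of coefficients of [f] and [g]
    outside [P], then their product is the only term of the coefficient of index [i + j] of [f * g]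
    that is not already in [P]. *)
Lemma poly_ext_prime P : prime_set P -> prime_set (poly_ext P).
Proof.
move=> primeP; have [P0 PD PM P1 PP] := primeP.
split=> [i|f g Pf Pg i|f g Pg i|/(_ 0%N)|f g Pfg].
- by rewrite coef0.
- by rewrite coefD; apply: PD.
- by rewrite coefM; apply: prime_set_sum => // j _; apply: PM.
- by rewrite coef1.
apply: contrapT => /not_orP[nPf nPg].
have min_coef h : ~ poly_ext P h ->
    exists2 i, ~ P h`_i & forall j, (j < i)%N -> P h`_j.
  move=> /existsNP nPh; have {nPh} : exists i, `[< ~ P h`_i >].
    by case: nPh => i nPi; exists i; apply/asboolP.
  case/ex_minnP => i /asboolP nPi i_min; exists i => // j ltji.
  by apply: contrapT => /asboolP /i_min; rewrite leqNgt ltji.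
have [i nPi i_min] := min_coef f nPf; have [j nPj j_min] := min_coef g nPg.
apply: (prime_set_nM primeP nPi nPj).
have lt_i : (i < (i + j).+1)%N by rewrite ltnS leq_addr.
have := Pfg (i + j)%N; rewrite coefM (bigD1 (Ordinal lt_i)) //= addKn => Pij.
set r := \sum_(l < _ | _) _ in Pij.
have Pr : P r.
  apply: prime_set_sum => // l /eqP/val_eqP /=; rewrite neq_ltn => /orP[lti|ltl].
    by rewrite mulrC; apply: PM; apply: i_min.
  by apply: PM; apply: j_min; rewrite ltn_subLR ?ltn_add2r // -ltnS.
by rewrite -[_ * _](addrK r); apply: prime_setB.
Qed.

Lemma poly_extC P a : P 0 -> poly_ext P a%:P <-> P a.
Proof.
move=> P0; split=> [/(_ 0%N)|Pa i]; first by rewrite coefC.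
by rewrite coefC; case: ifP.
Qed.

Lemma poly_ext_proper P Q : P 0 -> P `<` Q -> poly_ext P `<` poly_ext Q.
Proof.
move=> P0 [PQ nQP]; split=> [f Pf i|QP]; first exact: PQ.
apply: nQP => a Qa; apply/(poly_extC a P0)/QP/(poly_extC a) => //.
exact: PQ.
Qed.

(** Each coefficient comes with its own multiplier outside [P]; the induction on [f] multiplies them
    together, so that one constant serves the whole polynomial. *)
Lemma poly_ext_gen P d (s : 'I_d -> R) f : prime_set P ->
  (forall a, P a -> exists u x, ~ P u /\ u * a = \sum_i x i * s i) ->
  poly_ext P f ->
  exists u (x : 'I_d -> {poly R}),
    ~ P u /\ u%:P * f = \sum_i x i * (s i)%:P.
Proof.
move=> primeP s_gen; have [_ _ _ P1 _] := primeP.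
elim/poly_ind: f => [|f c IHf] Pf.
  exists 1, (fun=> 0); split=> //; rewrite mulr0 big1 // => i _.
  by rewrite mul0r.
have [|u [x [Pu ux]]] := IHf.
  by move=> i; have := Pf i.+1; rewrite coefD coefMX coefC /= addr0.
have [|v [y [Pv vy]]] := s_gen c.
  by have := Pf 0%N; rewrite coefD coefMX coefC /= add0r.
exists (u * v), (fun i => v *: x i * 'X + (u * y i)%:P).
split; first exact: prime_set_nM.
have -> : (u * v)%:P * (f * 'X + c%:P) =
    v%:P * (u%:P * f) * 'X + u%:P * (v * c)%:P.
  by rewrite !polyCM; ring.
rewrite ux vy rmorph_sum !mulr_sumr mulr_suml -big_split /=.
by apply: eq_bigr => i _; rewrite !polyCM -mul_polyC; ring.
Qed.

(* Either [P] is extended from its trace on the constants, or it is generated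
   over this extension by a polynomial of minimal degree outside of it. *)
Lemma regular_poly : regular_ring R -> regular_ring {poly R}.
Proof.
move=> regR P primeP; have [P0 PD PM P1 PP] := primeP.
pose p := [set a : R | P a%:P].
have primep : prime_set p := prime_set_preim polyC primeP.
have [p0 _ pM p1 _] := primep.
have [d [[c [c_prime c_lt]] [s [ps s_gen]]]] := regR _ primep.
have pP : poly_ext p `<=` P.
  move=> f pf; rewrite -[f]coefK poly_def; apply: prime_set_sum => // i _.
  by rewrite -mul_polyC mulrC; apply: PM; apply: pf.
have ext_prime i : (i <= d)%N -> prime_set (poly_ext (c i)).
  by case/c_prime => ? _; apply: poly_ext_prime.
have extP i : (i <= d)%N -> poly_ext (c i) `<=` poly_ext p.
  by case/c_prime => _ cp f cf j; apply: cp.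
have ext_lt i j : (i < j <= d)%N -> poly_ext (c i) `<` poly_ext (c j).
  move=> ijd; apply: poly_ext_proper; last exact: c_lt.
  have [lti lej] := andP ijd.
  by have [[]] := c_prime i (leq_trans (ltnW lti) lej).
have [Pp|/existsNP[f0 /not_implyP[Pf0 npf0]]] := pselect (P `<=` poly_ext p).
  exists d; split.
    exists (fun i => poly_ext (c i)); split=> // i led; split.
      exact: ext_prime.
    by move=> f /(extP _ led) /pP.
  exists (fun i => (s i)%:P); split=> // f /Pp /(poly_ext_gen primep s_gen).
  by move=> [u [x [Pu ux]]]; exists u%:P, x.
have [f [Pf npf] f_min] : exists2 f, P f /\ ~ poly_ext p f &
    forall g, P g -> (size g < size f)%N -> poly_ext p g.
  have : exists n, `[< exists f, [/\ P f, ~ poly_ext p f & size f = n] >].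
    by exists (size f0); apply/asboolP; exists f0.
  case/ex_minnP => n /asboolP[f [Pf npf szf]] n_min; exists f => // g Pg ltg.
  apply: contrapT => npg; move: ltg; rewrite ltnNge szf n_min //.
  by apply/asboolP; exists g.
(* Otherwise [f] without its leading term is an element of [P] of smaller size, hence extended from
   [p], and so is [f]. *)
have plf : ~ p (lead_coef f).
  move=> plf; apply: (npf); have szf : (0 < size f)%N.
    rewrite lt0n size_poly_eq0; apply/eqP => f0'; apply: npf.
    by rewrite f0' => i; rewrite coef0.
  pose g := f - lead_coef f *: 'X^((size f).-1).
  have Pg : P g.
    by apply: prime_setB => //; rewrite -mul_polyC mulrC; apply: PM.
  have gE i : g`_i = if i == (size f).-1 then 0 else f`_i.
    rewrite coefB coefZ coefXn; case: eqP => [->|_]; last by rewrite mulr0 subr0.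
    by rewrite mulr1 subrr.
  have /f_min : P g by []. 
  have ltg : (size g < size f)%N.
    rewrite -[X in (_ < X)%N]prednK // ltnS; apply/leq_sizeP => j lej.
    rewrite gE; case: eqP => // nj; apply: nth_default.
    by rewrite -[size f]prednK // ltn_neqAle lej andbT eq_sym; apply/eqP.
  move=> /(_ ltg) pg i; have := pg i; rewrite gE; case: eqP => // -> _.
  exact: plf.
(* Pseudo-division by [f]: the multipliers are powers of [lead_coef f], which lies outside [p], and
   a remainder shorter than [f] is extended from [p] by minimality. *)
have division g : P g -> exists u q, ~ p u /\ poly_ext p (u%:P * g - q * f).
  have [n] := ubnP (size g); elim: n g => // n IHn g; rewrite ltnS => szg Pg.
  have [ltg|leg] := ltnP (size g) (size f).
    by exists 1, 0; rewrite mul0r subr0 mul1r; split=> //; apply: f_min.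
  pose q := lead_coef g *: 'X^(size g - size f).
  pose g' := lead_coef f *: g - q * f.
  have Pg' : P g'.
    by apply: prime_setB => //; [rewrite -mul_polyC|]; apply: PM.
  have szf : (0 < size f)%N.
    rewrite lt0n size_poly_eq0; apply: contra_notN plf => /eqP->.
    by rewrite lead_coef0.
  have szg0 : (0 < size g)%N by apply: leq_trans leg.
  have ltg' : (size g' < size g)%N.
    rewrite -[X in (_ < X)%N]prednK // ltnS; apply/leq_sizeP => j lej.
    rewrite coefB coefZ /q -scalerAl coefZ coefXnM.
    have lek : (size g - size f <= (size g).-1)%N.
      by rewrite leq_subLR -{1}(prednK szg0) -(prednK szf) addSn ltnS leq_addl.
    rewrite ltnNge (leq_trans lek lej) /=.
    move: lej; rewrite leq_eqVlt => /predU1P[<-|ltj].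
      have -> : ((size g).-1 - (size g - size f) = (size f).-1)%N.
        by rewrite -!subn1 subnAC subKn.
      by rewrite -!lead_coefE mulrC subrr.
    have szj : (size g <= j)%N by rewrite -(prednK szg0).
    rewrite !nth_default ?mulr0 ?subrr //.
    by rewrite leq_subRL ?(leq_trans lek (ltnW ltj)) // subnK.
  have [u [q' [pu Hu]]] := IHn g' (leq_trans ltg' szg) Pg'.
  exists (u * lead_coef f), (q' + u *: q).
  split; first exact: prime_set_nM.
  suff <- : u%:P * g' - q' * f =
    (u * lead_coef f)%:P * g - (q' + u *: q) * f by [].
  by rewrite /g' polyCM -!mul_polyC; ring.
(* The chain gains [P] on top, strictly because of [f], and [f] joins the generators. *)
exists d.+1; split.
  exists (fun i => if (i <= d)%N then poly_ext (c i) else P); split=> [i _|i j].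
    case: ifP => led; last by split.
    by split; [exact: ext_prime|move=> g /(extP _ led) /pP].
  case/andP => ltij lejd; rewrite (leq_trans ltij lejd : (i <= d)%N).
  case: ifP => lej; first by apply: ext_lt; rewrite ltij.
  have led : (i <= d)%N := leq_trans ltij lejd.
  split; first by move=> g /(extP _ led) /pP.
  by move=> /(_ f Pf) /(extP _ led).
exists (fun i => if unlift ord0 i is Some j then (s j)%:P else f); split=> [i|g Pg].
  by case: unliftP => [j _|_] //; apply: ps.
have [u [q [pu pg]]] := division g Pg.
have [v [x [pv vx]]] := poly_ext_gen primep s_gen pg.
exists (v * u)%:P, (fun i => if unlift ord0 i is Some j then x j else v%:P * q).
split; first exact: (prime_set_nM primep pv pu).
rewrite big_ord_recl unlift_none.
under eq_bigr => i _ do rewrite liftK.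
by rewrite -vx polyCM; ring.
Qed.

End Extension.

Lemma mpoly_rmorph_ext (n : nat) (R : comNzRingType) (S : nzRingType)
    (f g : {rmorphism {mpoly R[n]} -> S}) :
  (forall c, f c%:MP = g c%:MP) -> (forall i, f 'X_i = g 'X_i) -> f =1 g.
Proof.
move=> fgC fgX; elim/mpolyind => [|c m p _ _ IHp]; first by rewrite !rmorph0.
rewrite !rmorphD IHp -mul_mpolyC !rmorphM fgC; congr (_ * _ + _).
rewrite mpolyXE_id !rmorph_prod; apply: eq_bigr => i _.
by rewrite !rmorphXn /= fgX.
Qed.

Lemma regular_mpoly (k : fieldType) (n : nat) : regular_ring {mpoly k[n]}.
Proof.
elim: n => [|n IHn].
  apply: (@regular_ring_iso _ _ (mmap idfun (fun=> 0)) (@mpolyC 0 k)).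
  - apply: (@mpoly_rmorph_ext _ _ _ (@mpolyC 0 k \o mmap idfun (fun=> 0)) idfun).
      by move=> c; rewrite /= mmapC.
    by case.
  - by move=> c; apply: (mmapC (fun=> 0) idfun).
  - exact: regular_field.
(* The inverse of [muni]: widen the coefficients and substitute the last variable for ['X]. *)
pose multi : {rmorphism {poly {mpoly k[n]}} -> {mpoly k[n.+1]}} :=
  horner_eval 'X_ord_max \o map_poly (@mwiden n k).
have multiC p : multi p%:P = mwiden p by rewrite /= map_polyC /horner_eval hornerC.
have multiX : multi 'X = 'X_ord_max by rewrite /= map_polyX /horner_eval hornerX.
clearbody multi.
have muniX (i : 'I_n) :
    muni 'X_(widen_ord (leqnSn n) i) = ('X_i)%:P :> {poly {mpoly k[n]}}.
  rewrite /muni mmapX mmap1U; case: splitP => [j /= ij|j /=].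
    by congr ('X__)%:P; apply/val_inj.
  by rewrite ord1 addn0 => ij; have := ltn_ord i; rewrite ij ltnn.
have muniX' : muni 'X_ord_max = 'X :> {poly {mpoly k[n]}}.
  rewrite /muni mmapX mmap1U; case: splitP => [j /= nj|//].
  by have := ltn_ord j; rewrite -nj ltnn.
apply: (@regular_ring_iso _ {poly {mpoly k[n]}} (@muni n k) multi _ _
  (regular_poly IHn)).
- apply: (@mpoly_rmorph_ext _ _ _ (multi \o @muni n k) idfun) => [c|i].
    by change (multi (muni c%:MP) = c%:MP); rewrite muniC multiC mwidenC.
  have [j ->|->] := unliftP ord_max i.
    have -> : lift ord_max j = widen_ord (leqnSn n) j.
      by apply/val_inj; rewrite /= /bump leqNgt ltn_ord.
    set l := widen_ord _ j; change (multi (muni 'X_l) = 'X_l).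
    by rewrite muniX multiC /= mwidenX mnmwiden1.
  by change (multi (muni 'X_ord_max) = 'X_ord_max); rewrite muniX' multiX.
- have muni_multiC p : muni (multi p%:P) = p%:P.
    apply: (@mpoly_rmorph_ext _ _ _ (@muni n k \o multi \o polyC) polyC) => [c|i].
      change (muni (multi (c%:MP)%:P) = (c%:MP)%:P).
      by rewrite multiC mwidenC muniC.
    change (muni (multi ('X_i)%:P) = ('X_i)%:P).
    by rewrite multiC mwidenX mnmwiden1 muniX.
  elim/poly_ind => [|p c IHp]; first by rewrite !rmorph0.
  rewrite !rmorphD !rmorphM IHp; congr (_ * _ + _); last exact: muni_multiC.
  by rewrite multiX; apply: muniX'.
Qed.

End RegularRings.

(** * Subrings of a field and their localizations *)

Section Subrings.
Variable K : fieldType.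
Implicit Types (A O p : set K).

Lemma subring0 A : is_subring A -> A 0.
Proof. by case=> A1 AB _; rewrite -(subrr 1); apply: AB. Qed.

Lemma subringN A a : is_subring A -> A a -> A (- a).
Proof.
move=> subA Aa; rewrite -sub0r; case: (subA) => _ AB _.
by apply: AB => //; apply: subring0.
Qed.

Lemma subringD A a b : is_subring A -> A a -> A b -> A (a + b).
Proof.
move=> subA Aa Ab; rewrite -[b]opprK; case: (subA) => _ AB _.
by apply: AB => //; apply: subringN.
Qed.

Lemma subringM A a b : is_subring A -> A a -> A b -> A (a * b).
Proof. by case=> _ _ AM; apply: AM. Qed.

Lemma subringX A a n : is_subring A -> A a -> A (a ^+ n).
Proof.
move=> subA Aa; elim: n => [|n IHn]; first by case: subA.
by rewrite exprS; apply: subringM.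
Qed.

Lemma subring_sum A (I : Type) (r : seq I) (Q : pred I) (F : I -> K) :
  is_subring A -> (forall i, Q i -> A (F i)) -> A (\sum_(i <- r | Q i) F i).
Proof.
move=> subA; apply: (big_ind (fun a => A a)); first exact: subring0.
by move=> a b; apply: subringD.
Qed.

Lemma gen_ring_subring (S : set K) : is_subring (gen_ring S).
Proof.
split=> [B [[]]//|a b Sa Sb B BS|a b Sa Sb B BS].
  by case: (BS) => subB _; case: (subB) => _ + _; apply; [apply: Sa|apply: Sb].
by case: (BS) => subB _; apply: subringM => //; [apply: Sa|apply: Sb].
Qed.

Lemma gen_ring_sub (S : set K) : S `<=` gen_ring S.
Proof. exact: sub_smallest. Qed.

Lemma gen_ring_min (S A : set K) : is_subring A -> S `<=` A -> gen_ring S `<=` A.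
Proof. by move=> subA SA; apply: smallest_sub. Qed.

Lemma prime_sub A p a : is_prime A p -> p a -> A a.
Proof. by case=> pA _ _ _ _ /pA. Qed.

Lemma prime_nonzero A p s : is_prime A p -> ~ p s -> s != 0.
Proof. by case=> _ [p0 _] _ _ _ ps; apply: contra_notN ps => /eqP->. Qed.

Lemma prime_notM A p a b : is_prime A p -> A a -> A b -> ~ p a -> ~ p b ->
  ~ p (a * b).
Proof. by case=> _ _ _ _ pP Aa Ab npa npb /(pP _ _ Aa Ab)[]. Qed.

Section Localization.
Variables A p : set K.
Hypotheses (subA : is_subring A) (primep : is_prime A p).

Lemma localization_sub : A `<=` localization A p.
Proof.
move=> a Aa; exists a, 1; rewrite divr1; split=> //; first by case: subA.
by case: primep.
Qed.

Lemma localization_inv s : A s -> ~ p s -> localization A p s^-1.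
Proof. by move=> As ps; exists 1, s; rewrite div1r; split=> //; case: subA. Qed.

Lemma localization_subring : is_subring (localization A p).
Proof.
split=> [|_ _ [a [s [Aa As ps ->]]] [b [t [Ab At pt ->]]]
         |_ _ [a [s [Aa As ps ->]]] [b [t [Ab At pt ->]]]].
- by apply: localization_sub; case: subA.
- have [s0 t0] := (prime_nonzero primep ps, prime_nonzero primep pt).
  exists (a * t - b * s), (s * t); split.
  + by apply: subringD => //; [|apply: subringN => //]; apply: subringM.
  + exact: subringM.
  + exact: (prime_notM primep).
  + by field; rewrite s0 t0.
- exists (a * b), (s * t); split; try exact: subringM.
    exact: (prime_notM primep).
  by rewrite invfM mulrACA.
Qed.

Definition localized_ideal q : set K :=
  [set f | exists a s, [/\ q a, A s, ~ p s & f = a / s]].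

Lemma localized_ideal_mem q a s : is_prime A q -> q `<=` p -> A a -> A s ->
  ~ p s -> localized_ideal q (a / s) <-> q a.
Proof.
move=> primeq qp Aa As ps; split=> [[b [t [qb At pt]]]|qa]; last by exists a, s.
have [s0 t0] := (prime_nonzero primep ps, prime_nonzero primep pt).
move/eqP; rewrite eqr_div // => /eqP abE.
have [_ _ qM _ qP] := primeq.
have : q (a * t) by rewrite abE mulrC; apply: qM.
by case/(qP _ _ Aa At) => // /qp.
Qed.

Lemma localized_ideal_prime q : is_prime A q -> q `<=` p ->
  is_prime (localization A p) (localized_ideal q).
Proof.
move=> primeq qp; have [qA [q0 qD] qM q1 qP] := primeq.
have A1 : A 1 by case: subA.
have p1 : ~ p 1 by case: primep.
split.
- by move=> _ [a [s [qa As ps ->]]]; exists a, s; split=> //; apply: qA.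
- split; first by exists 0, 1; rewrite mul0r.
  move=> _ _ [a [s [qa As ps ->]]] [b [t [qb At pt ->]]].
  have [s0 t0] := (prime_nonzero primep ps, prime_nonzero primep pt).
  exists (t * a + s * b), (s * t); split.
  + by apply: qD; apply: qM.
  + exact: subringM.
  + exact: (prime_notM primep).
  + by field; rewrite s0 t0.
- move=> _ _ [a [s [Aa As ps ->]]] [b [t [qb At pt ->]]].
  exists (a * b), (s * t); split; first exact: qM.
  + exact: subringM.
  + exact: (prime_notM primep).
  + by rewrite invfM mulrACA.
- by rewrite -(divr1 1) => /(localized_ideal_mem primeq qp A1 A1 p1).
- move=> _ _ [a [s [Aa As ps ->]]] [b [t [Ab At pt ->]]].
  rewrite mulrACA -invfM.
  move/localized_ideal_mem => /(_ primeq qp (subringM subA Aa Ab)).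
  move=> /(_ (subringM subA As At) (prime_notM primep As At ps pt)).
  by case/(qP _ _ Aa Ab) => q'; [left|right]; apply/localized_ideal_mem.
Qed.

Lemma max_ideal_localization :
  max_ideal (localization A p) = localized_ideal p.
Proof.
apply/seteqP; split=> f.
  case=> [[a [s [Aa As ps ->]]]] [/eqP|nf].
    rewrite mulf_eq0 invr_eq0 (negbTE (prime_nonzero primep ps)) orbF => /eqP->.
    by exists 0, s; split=> //; case: primep => _ [].
  exists a, s; split=> //; apply: contrapT => pa; apply: nf.
  by exists s, a; rewrite invf_div.
move=> [a [s [pa As ps ->]]]; have Aa := prime_sub primep pa.
split; first by exists a, s.
have [->|a0] := eqVneq a 0; [by left; rewrite mul0r|right].
rewrite invf_div => -[b [t [Ab At pt /eqP]]].
rewrite eqr_div ?(prime_nonzero primep pt) // => /eqP stE.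
apply: (prime_notM primep As At ps pt).
by rewrite stE; case: primep => _ _ + _ _; apply.
Qed.

Lemma max_ideal_prime :
  is_prime (localization A p) (max_ideal (localization A p)).
Proof. by rewrite max_ideal_localization; apply: localized_ideal_prime. Qed.

End Localization.

Lemma prime_preim_rmorph (R : comNzRingType) (e : {rmorphism R -> K}) p :
  is_prime (range e) p -> prime_set (e @^-1` p).
Proof.
case=> pA [p0 pD] pM p1 pP; split; rewrite /preimage /=.
- by rewrite rmorph0.
- by move=> a b pa pb; rewrite rmorphD; apply: pD.
- by move=> a b pb; rewrite rmorphM; apply: pM => //; exists a.
- by rewrite rmorph1.
- by move=> a b; rewrite rmorphM => /pP; apply; [exists a|exists b].
Qed.

Lemma range_subring (R : comNzRingType) (e : {rmorphism R -> K}) :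
  is_subring (range e).
Proof.
split=> [|_ _ [a _ <-] [b _ <-]|_ _ [a _ <-] [b _ <-]].
- by exists 1; rewrite ?rmorph1.
- by exists (a - b); rewrite ?rmorphB.
- by exists (a * b); rewrite ?rmorphM.
Qed.

(** Since [e] is injective, the chain and the generators given by [regular_at] pass to [range e];
    the multiplier [u] becomes part of the denominators in the localization. *)
Lemma regular_localization (R : comNzRingType) (e : {rmorphism R -> K}) p :
  injective e -> regular_ring R -> is_prime (range e) p ->
  regular (localization (range e) p).
Proof.
move=> e_inj regR primep.
have [d [[c [c_prime c_lt]] [s [ps s_gen]]]] := regR _ (prime_preim_rmorph primep).
have subA := range_subring e.
have A_e a : range e (e a) by exists a.
have im_c i a : (e @` c i) (e a) <-> c i a.
  by split=> [[b cb /e_inj <-]|ca] //; exists a.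
have im_prime i : (i <= d)%N -> is_prime (range e) (e @` c i).
  case/c_prime => -[c0 cD cM c1 cP] _; split.
  - by move=> _ [a _ <-].
  - split; first by rewrite -(rmorph0 e) im_c.
    by move=> _ _ [a ca <-] [b cb <-]; rewrite -rmorphD im_c; apply: cD.
  - by move=> _ _ [a _ <-] [b cb <-]; rewrite -rmorphM im_c; apply: cM.
  - by rewrite -(rmorph1 e) im_c.
  - by move=> _ _ [a _ <-] [b _ <-]; rewrite -rmorphM !im_c; apply: cP.
have im_p i : (i <= d)%N -> e @` c i `<=` p.
  by case/c_prime => _ cp _ [a /cp pa <-].
have A1 : range e 1 by case: subA.
have p1 : ~ p 1 by case: primep.
exists d; split.
  exists (fun i => localized_ideal (range e) p (e @` c i)); split=> [i|i j ltij].
    by have := ltn_ord i; rewrite ltnS => led; apply: localized_ideal_prime; auto.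
  have [led jed] : (i <= d)%N /\ (j <= d)%N.
    by split; rewrite -ltnS ltn_ord.
  have [|cij ncji] := c_lt i j; first by rewrite ltij.
  split=> [_ [_ [t [[a ca <-] At pt ->]]]|sub].
    by exists (e a), t; split=> //; rewrite im_c; apply: cij.
  apply: ncji => a ca; apply/im_c.
  have /sub : localized_ideal (range e) p (e @` c j) (e a / 1).
    by exists (e a), 1; split=> //; rewrite im_c.
  by move/(localized_ideal_mem primep (im_prime i led) (im_p i led)); apply.
exists (e \o s); rewrite max_ideal_localization //; split=> [i|].
  by exists (e (s i)), 1; rewrite divr1; split=> //; apply: ps.
move=> _ [b [t [pa At pt ->]]].
have [a _ aE] := prime_sub primep pa; subst b.
have [u [x [pu ux]]] := s_gen a pa.
have [u0 t0] := (prime_nonzero primep pu, prime_nonzero primep pt).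
exists (fun i => e (x i) / (e u * t)).
  move=> i; exists (e (x i)), (e u * t); split=> //; first exact: subringM.
  exact: (prime_notM primep).
transitivity (e (u * a) / (e u * t)); first by rewrite rmorphM; field; rewrite u0 t0.
rewrite ux rmorph_sum mulr_suml; apply: eq_bigr => i _.
by rewrite rmorphM mulrAC.
Qed.

(** A prime of [A] contains no unit of [A], so the denominators [s] lie outside [p] and can be
    cleared. This serves twice: to see local rings of a principal open set as local rings of affine
    space, and to see local rings of the Kummer cover as local rings of a chart of E(6)^4. *)
Lemma localization_fractions A0 A p : is_subring A0 -> is_subring A ->
  A0 `<=` A -> is_prime A p ->
  (forall a, A a -> exists b s, [/\ A0 b, A0 s, s != 0, A s^-1 & a = b / s]) ->
  is_prime A0 (p `&` A0) /\ localization A p = localization A0 (p `&` A0).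
Proof.
move=> subA0 subA sub0 primep frac; have [pA [p0 pD] pM p1 pP] := primep.
have A00 := subring0 subA0.
split.
  split.
  - by move=> a [].
  - by split=> // a b [pa Aa] [pb Ab]; split; [apply: pD|apply: subringD].
  - by move=> a b Aa [pb Ab]; split; [apply: pM => //; apply: sub0|apply: subringM].
  - by case.
  - move=> a b Aa Ab [/(pP _ _ (sub0 _ Aa) (sub0 _ Ab)) pab _].
    by case: pab; [left|right].
apply/seteqP; split=> _ [a [s [Aa As ps ->]]]; last first.
  by exists a, s; split; auto => ?; apply: ps.
have [b [t [A0b A0t t0 Ait ->]]] := frac a Aa.
have [c [u [A0c A0u u0 Aiu sE]]] := frac s As.
have s0 := prime_nonzero primep ps.
have pc : ~ p c.
  by move=> pc; apply: ps; rewrite sE mulrC; apply: pM.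
have pt : ~ p t by move=> pt; apply: p1; rewrite -(mulVf t0); apply: pM.
exists (b * u), (t * c); split; try exact: subringM.
  by case=> ptc _; apply: (prime_notM primep (sub0 _ A0t) (sub0 _ A0c) pt pc ptc).
have c0 := prime_nonzero primep pc.
by rewrite sE; field; rewrite t0 u0 c0.
Qed.

(** Krull's argument: by Zorn's lemma there is an ideal maximal among those containing [J] and
    avoiding [M], and such an ideal is prime. *)
Lemma exists_prime A J (M : set K) : is_subring A -> J `<=` A -> J 0 ->
  (forall a b, J a -> J b -> J (a + b)) ->
  (forall a b, A a -> J b -> J (a * b)) ->
  M 1 -> (forall a b, M a -> M b -> M (a * b)) -> (forall a, M a -> ~ J a) ->
  exists p, [/\ is_prime A p, J `<=` p & forall a, M a -> ~ p a].
Proof.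
move=> subA JA J0 JD JM M1 MM MJ.
pose ideal I := [/\ J `<=` I, I `<=` A, forall a b, I a -> I b -> I (a + b),
  forall a b, A a -> I b -> I (a * b) & forall a, M a -> ~ I a].
pose T := {I : set K | ideal I}.
pose R (I1 I2 : T) := `[< sval I1 `<=` sval I2 >].
have idJ : ideal J by split.
have [| | | |[p idp] p_max] := @Zorn T R.
- by move=> I; apply/asboolP.
- by move=> I1 I2 I3 /asboolP I12 /asboolP I23; apply/asboolP => a /I12 /I23.
- move=> [I1 id1] [I2 id2] /asboolP /= I12 /asboolP /= I21.
  by apply: eq_exist; apply/seteqP.
- move=> C tot; have [[I0 CI0]|C0] := pselect (exists I, C I); last first.
    by exists (exist _ J idJ) => I CI; case: C0; exists I.
  pose U := [set a | exists2 I, C I & sval I a].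
  have idU : ideal U; last first.
    by exists (exist _ U idU) => I CI; apply/asboolP => a Ia; exists I.
  split.
  + by move=> a Ja; exists I0 => //; case: (svalP I0) => + _ _ _ _; apply.
  + by move=> a [I CI Ia]; case: (svalP I) => _ + _ _ _; apply.
  + move=> a b [I CI Ia] [I' CI' Ib].
    case: (tot _ _ CI CI') => /asboolP sub; [exists I'|exists I] => //.
      by case: (svalP I') => _ _ + _ _; apply => //; apply: sub.
    by case: (svalP I) => _ _ + _ _; apply => //; apply: sub.
  + by move=> a b Aa [I CI Ib]; exists I => //; case: (svalP I) => _ _ _ + _; apply.
  + by move=> a Ma [I CI]; case: (svalP I) => _ _ _ _; apply.
have [Jp pA pD pM Mp] := idp.
have p0 : p 0 by apply: Jp.
exists p; split=> //; split=> //; first exact: Mp.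
(* By maximality, the ideal generated by [p] and [a] meets [M]. *)
have extend a : A a -> ~ p a -> exists b c, [/\ p b, A c & M (b + c * a)].
  move=> Aa npa; apply: contrapT => nM.
  pose I := [set x | exists b c, [/\ p b, A c & x = b + c * a]].
  have A1 : A 1 by case: subA.
  have A0 := subring0 subA.
  have pI : p `<=` I by move=> b pb; exists b, 0; rewrite mul0r addr0.
  have idI : ideal I.
    split.
    - by move=> b /Jp /pI.
    - move=> _ [b [c [pb Ac ->]]]; apply: subringD => //; first exact: pA.
      exact: subringM.
    - move=> _ _ [b [c [pb Ac ->]]] [b' [c' [pb' Ac' ->]]].
      exists (b + b'), (c + c'); split; [exact: pD|exact: subringD|ring].
    - move=> x _ Ax [b [c [pb Ac ->]]].
      exists (x * b), (x * c); split; [exact: pM|exact: subringM|ring].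
    - by move=> x Mx [b [c [pb Ac xE]]]; apply: nM; exists b, c; rewrite -xE.
  apply: npa; have /(congr1 sval) /= <- : exist _ I idI = exist _ p idp :> T.
    by apply: p_max; apply/asboolP.
  exists 0, 1.
  by rewrite add0r mul1r.
move=> a b Aa Ab pab; apply: contrapT => /not_orP[npa npb].
have [c [d [pc Ad Mcd]]] := extend a Aa npa.
have [c' [d' [pc' Ad' Mcd']]] := extend b Ab npb.
apply: (Mp _ (MM _ _ Mcd Mcd')).
(* Every term of the expansion lies in [p], the last one because [a * b] does, whereas the product
   lies in [M]. *)
have -> : (c + d * a) * (c' + d' * b) =
  (c' + d' * b) * c + (d * a) * c' + (d * d') * (a * b) by ring.
by apply: (pD); [apply: (pD)|]; apply: pM => //;
  repeat (apply: subringD || apply: subringM || apply: pA) => //.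
Qed.

End Subrings.

(** * Kummer extensions *)

Section KummerExtension.
Variables (F K : fieldType) (v : {rmorphism F -> K}).
Variables (g : {rmorphism K -> K}) (n' : nat).
Let n := n'.+1.
Variables (z e : K).
Hypotheses (n_neq0 : n%:R != 0 :> K) (z_prim : n.-primitive_root z).
Hypotheses (gv : forall f, g (v f) = v f).
Hypotheses (gz : g z = z) (ge : g e = z * e) (e0 : e != 0).

(** The powers of [e] are eigenvectors of [g] with distinct eigenvalues [z ^+ i]. Averaging the
    images of the relation under the powers of [g] against a character isolates one coefficient,
    multiplied by [n], which is invertible. *)
Lemma kummer_free (c : 'I_n -> F) :
  \sum_i v (c i) * e ^+ i = 0 -> forall i, c i = 0.
Proof.
move=> c0 m.
have gc0 j : \sum_i v (c i) * z ^+ (i * j) * e ^+ i = 0.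
  elim: j => [|j IHj]; first by under eq_bigr => i _ do rewrite muln0 mulr1.
  have := congr1 g IHj; rewrite rmorph0 rmorph_sum => gIH; rewrite -[RHS]gIH.
  apply: eq_bigr => i _.
  by rewrite !rmorphM !rmorphXn gv gz ge exprMn mulnS exprD; ring.
have z0 : z != 0.
  apply/eqP => z0; have := prim_expr_order z_prim.
  by rewrite z0 expr0n => /eqP; rewrite eq_sym oner_eq0.
(* The factor [z ^+ ((n - m) * j)] is the inverse of [z ^+ (m * j)], written with a natural
   exponent. *)
have : \sum_(j < n) z ^+ ((n - m) * j) * \sum_i v (c i) * z ^+ (i * j) * e ^+ i = 0.
  by rewrite big1 // => j _; rewrite gc0 mulr0.
under eq_bigr => j _ do rewrite mulr_sumr.
rewrite exchange_big (bigD1 m) //= [X in _ + X]big1 => [|i nim]; last first.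
  pose t := z ^+ (n - m + i).
  have -> : \sum_(j < n) z ^+ ((n - m) * j) * (v (c i) * z ^+ (i * j) * e ^+ i)
    = v (c i) * e ^+ i * \sum_(j < n) t ^+ j.
    rewrite mulr_sumr; apply: eq_bigr => j _.
    by rewrite /t -exprM mulnDl exprD; ring.
  have t1 : t - 1 != 0.
    rewrite subr_eq0 -(prim_order_dvd z_prim); apply: contra_neqN nim => tdvd.
    have ltm := ltn_ord m; have lti := ltn_ord i; apply/val_inj => /=.
    have /eqP : (n - m + i = m + (n - m) %[mod n])%N.
      by rewrite subnKC ?(ltnW ltm) // modnn; apply/eqP.
    by rewrite addnC eqn_modDr !modn_small // => /eqP.
  suff -> : \sum_(j < n) t ^+ j = 0 by rewrite mulr0.
  have tn : t ^+ n = 1.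
    by rewrite /t -exprM mulnC exprM (prim_expr_order z_prim) expr1n.
  by apply: (mulfI t1); rewrite -subrX1 mulr0 tn subrr.
have zn (j : nat) : z ^+ ((n - m) * j) * z ^+ (m * j) = 1.
  rewrite -exprD -mulnDl subnK ?(ltnW (ltn_ord m)) //.
  by rewrite exprM (prim_expr_order z_prim) expr1n.
rewrite addr0; under eq_bigr => j _.
  have -> : z ^+ ((n - m) * j) * (v (c m) * z ^+ (m * j) * e ^+ m) =
    v (c m) * e ^+ m.
    by rewrite -[RHS]mulr1 -(zn j); ring.
  over.
rewrite sumr_const card_ord -mulr_natl => /eqP.
rewrite !mulf_eq0 (negbTE n_neq0) expf_eq0 (negbTE e0) andbF orbF /=.
by rewrite (fmorph_eq0 v) => /eqP.
Qed.

Lemma kummer_inj (b c : 'I_n -> F) :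
  \sum_i v (b i) * e ^+ i = \sum_i v (c i) * e ^+ i -> b =1 c.
Proof.
move=> bc i; apply/eqP; rewrite -subr_eq0; apply/eqP.
apply: (kummer_free (c := fun i => b i - c i)).
under eq_bigr => j _ do rewrite rmorphB mulrBl.
by rewrite sumrB bc subrr.
Qed.

Lemma sum_delta (b : F) : \sum_(i < n) v (if i == ord0 then b else 0) * e ^+ i = v b.
Proof.
rewrite (bigD1 ord0) //= mulr1 big1 ?addr0 // => i /negPf ni.
by rewrite ni rmorph0 mul0r.
Qed.

Definition kummer_span (B : set F) : set K :=
  [set x | exists2 b : 'I_n -> F, (forall i, B (b i)) &
    x = \sum_i v (b i) * e ^+ i].

(** Multiplication by an element of [F] acts on each component separately. Any component of a
    denominator of [f] is therefore itself a denominator of [f], now over [B]. *)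
Lemma kummer_component B f x (s : 'I_n -> F) : kummer_span B x ->
  v f * (\sum_i v (s i) * e ^+ i) = x -> forall i, B (f * s i).
Proof.
move=> [b Bb ->]; rewrite mulr_sumr => fE i.
rewrite (_ : f * s i = b i) //; move: i.
apply: (kummer_inj (b := fun i => f * s i)); rewrite -fE.
by apply: eq_bigr => i _; rewrite rmorphM mulrA.
Qed.

Section Ring.
Variables (B : set F) (c : F).
Hypotheses (subB : is_subring B) (cE : v c = e ^+ n) (Bc : B c) (Bci : B c^-1).

Section Module.
Variable Q : set F.
Hypotheses (Q0 : Q 0) (QD : forall a b, Q a -> Q b -> Q (a + b)).
Hypothesis QM : forall a b, B a -> Q b -> Q (a * b).

Lemma kummer_span0 : kummer_span Q 0.
Proof. by exists (fun=> 0) => //; rewrite big1 // => i _; rewrite rmorph0 mul0r. Qed.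

Lemma kummer_spanD x y : kummer_span Q x -> kummer_span Q y ->
  kummer_span Q (x + y).
Proof.
move=> [a Qa ->] [b Qb ->]; exists (fun i => a i + b i).
  by move=> i; apply: QD.
by rewrite -big_split; apply: eq_bigr => i _; rewrite rmorphD mulrDl.
Qed.

(** Exponents are reduced modulo [n] by means of [e ^+ n = v c] with [c] in [B]. The module [Q] is
    left general because it is taken both as [B] and as a prime of [B]. *)
Lemma kummer_span_monomial b m : Q b -> kummer_span Q (v b * e ^+ m).
Proof.
move=> Qb; pose r := Ordinal (ltn_pmod m (ltn0Sn n')).
exists (fun i => if i == r then c ^+ (m %/ n) * b else 0).
  by move=> i; case: ifP => _ //; apply: QM => //; apply: subringX.
rewrite (bigD1 r) //= eqxx big1 ?addr0 => [|i /negPf ni]; last first.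
  by rewrite ni rmorph0 mul0r.
rewrite [in LHS](divn_eq m n) exprD mulnC exprM -cE -rmorphXn mulrA.
by rewrite -rmorphM [b * _]mulrC.
Qed.

Lemma kummer_spanM x y : kummer_span B x -> kummer_span Q y ->
  kummer_span Q (x * y).
Proof.
move=> [a Ba ->] [b Qb ->]; rewrite mulr_suml.
apply: (big_ind (kummer_span Q)) => [||i _];
  [exact: kummer_span0|exact: kummer_spanD|].
rewrite mulr_sumr.
apply: (big_ind (kummer_span Q)) => [||j _];
  [exact: kummer_span0|exact: kummer_spanD|].
by rewrite mulrACA -rmorphM -exprD; apply: kummer_span_monomial; apply: QM.
Qed.

End Module.

Let B0 : B 0 := subring0 subB.
Let BD a b : B a -> B b -> B (a + b). Proof. exact: subringD. Qed.
Let BM a b : B a -> B b -> B (a * b). Proof. exact: subringM. Qed.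

Lemma kummer_span_sub b : B b -> kummer_span B (v b).
Proof.
by move=> Bb; rewrite -[v b]mulr1 -(expr0 e); apply: kummer_span_monomial.
Qed.

Lemma kummer_span_gen : kummer_span B e.
Proof.
rewrite -[e]mul1r -(rmorph1 v) -[e in _ * e]expr1.
by apply: kummer_span_monomial => //; case: subB.
Qed.

Lemma kummer_span_genV : kummer_span B e^-1.
Proof.
suff -> : e^-1 = v c^-1 * e ^+ n' by apply: kummer_span_monomial.
by rewrite fmorphV cE exprS; field; rewrite e0 expf_neq0.
Qed.

Lemma kummer_span_subring : is_subring (kummer_span B).
Proof.
split=> [|x y Ax [b Bb ->]|x y]; last exact: kummer_spanM.
  by rewrite -(rmorph1 v); apply: kummer_span_sub; case: subB.
apply: kummer_spanD => //; exists (fun i => - b i).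
  by move=> i; apply: subringN.
by rewrite -sumrN; apply: eq_bigr => i _; rewrite rmorphN mulNr.
Qed.

(** A nonzero denominator has a nonzero component, and [kummer_component] turns that component into
    a denominator of [f]. *)
Lemma kummer_fractions f x s : kummer_span B x -> kummer_span B s -> s != 0 ->
  v f = x / s -> exists a b, [/\ B a, B b, b != 0 & f = a / b].
Proof.
move=> Ax [b Bb ->] b0 fE.
have [i bi0] : exists i, b i != 0.
  apply: contrapT => nb; case/eqP: b0; apply: big1 => i _.
  suff -> : b i = 0 by rewrite rmorph0 mul0r.
  by apply: contra_notP nb => /eqP bi0; exists i.
exists (f * b i), (b i); split=> //; last by rewrite mulfK.
by apply: (kummer_component Ax); rewrite fE divfK.
Qed.

(* Every invariant regular at [P] has a denominator among the components of a
   denominator at [P], one of which does not lie in [p]. *)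
Lemma kummer_local_ring p : is_prime B p ->
  exists2 P, is_prime (kummer_span B) P &
    [set f : F | localization (kummer_span B) P (v f)] = localization B p.
Proof.
move=> primep; have [pB [p0 pD] pM p1 pP] := primep.
(* A prime over [p] is obtained as one containing the span of [p] and avoiding the image of the
   complement of [p]; the two are disjoint, as the component of index 0 shows. *)
pose J := kummer_span p; pose M := [set v b | b in B `\` p].
have subA := kummer_span_subring.
have [|||||||P [primeP JP MP]] := @exists_prime K (kummer_span B) J M subA.
- by move=> _ [b pb ->]; exists b => // i; apply: pB.
- exact: kummer_span0.
- exact: kummer_spanD.
- exact: kummer_spanM.
- by exists 1; rewrite ?rmorph1 //; split=> //; case: subB.
- move=> _ _ [a [Ba pa] <-] [b [Bb pb] <-]; exists (a * b); rewrite ?rmorphM //.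
  by split; [apply: subringM|apply: (prime_notM primep)].
- move=> _ [a [Ba pa] <-] [b pb]; rewrite -sum_delta => /kummer_inj /(_ ord0).
  by rewrite eqxx => aE; apply: pa; rewrite aE.
exists P => //; apply/seteqP; split=> f.
  case=> x [s [Ax [b Bb sE] Ps fE]].
  have [i pbi] : exists i, ~ p (b i).
    apply/existsNP => pb; apply: Ps; apply: JP.
    by exists b.
  exists (f * b i), (b i); split=> //; last first.
    by rewrite mulfK // (prime_nonzero primep pbi).
  apply: (kummer_component Ax); rewrite fE -sE divfK //.
  exact: prime_nonzero primeP Ps.
case=> a [b [Ba Bb pb ->]]; exists (v a), (v b); split.
- exact: kummer_span_sub.
- exact: kummer_span_sub.
- by apply: MP; exists b.
- by rewrite fmorph_div.
Qed.

End Ring.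
End KummerExtension.

(** * Transfer of identities between fields *)

Section Transfer.
Variables (S : comNzRingType) (K L : fieldType).
Variables (u : {rmorphism S -> K}) (v : {rmorphism S -> {poly L}}).

(** Inclusion of kernels would be too strong: in the main application [v] sends the equations of the
    curves, which [u] kills, to a nonzero polynomial. Only elements whose image is a monomial, the
    homogeneous ones, are compared. *)
Definition monomial_kernel := forall r c n, u r = 0 -> v r = c *: 'X^n -> c = 0.

(* [z] and [l] are the values of one fraction of [S], homogeneous of degree
   [n] once [v] has replaced the generators of [S] by monomials. *)
Definition transfer (n : nat) (z : K) (l : L) : Prop :=
  exists r s N c d, [/\ d != 0, v r = c *: 'X^(n + N), v s = d *: 'X^N,
    z = u r / u s & l = c / d].

Hypothesis kerP : monomial_kernel.

Lemma transfer_base r c n : v r = c *: 'X^n -> transfer n (u r) c.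
Proof.
move=> vr; exists r, 1, 0%N, c, 1.
by rewrite oner_eq0 addn0 expr0 scale1r !rmorph1 !divr1.
Qed.

Lemma transfer_den s d N : d != 0 -> v s = d *: 'X^N -> u s != 0.
Proof. by move=> d0 vs; apply: contra_neq d0 => us0; apply: kerP vs. Qed.

Lemma transferB n z z' l l' :
  transfer n z l -> transfer n z' l' -> transfer n (z - z') (l - l').
Proof.
move=> [r [s [N [c [d [d0 vr vs -> ->]]]]]].
move=> [r' [s' [N' [c' [d' [d0' vr' vs' -> ->]]]]]].
have [us us'] := (transfer_den d0 vs, transfer_den d0' vs').
exists (r * s' - r' * s), (s * s'), (N + N')%N, (c * d' - c' * d), (d * d').
split; first exact: mulf_neq0.
- rewrite rmorphB !rmorphM vr vs vr' vs' -!scalerAl -!scalerAr -!exprD !scalerA.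
  by rewrite [(n + N' + N)%N]addnAC -!addnA scalerBl.
- by rewrite rmorphM vs vs' -scalerAl -scalerAr -exprD scalerA.
- by rewrite rmorphB !rmorphM; field; rewrite us us'.
- by field; rewrite d0 d0'.
Qed.

Lemma transferM n m z z' l l' :
  transfer n z l -> transfer m z' l' -> transfer (n + m) (z * z') (l * l').
Proof.
move=> [r [s [N [c [d [d0 vr vs -> ->]]]]]].
move=> [r' [s' [N' [c' [d' [d0' vr' vs' -> ->]]]]]].
have [us us'] := (transfer_den d0 vs, transfer_den d0' vs').
exists (r * r'), (s * s'), (N + N')%N, (c * c'), (d * d').
split; first exact: mulf_neq0.
- by rewrite rmorphM vr vr' -scalerAl -scalerAr -exprD scalerA addnACA.
- by rewrite rmorphM vs vs' -scalerAl -scalerAr -exprD scalerA.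
- by rewrite !rmorphM; field; rewrite us us'.
- by field; rewrite d0 d0'.
Qed.

Lemma transfer_eq0 n z l : transfer n z l -> z = 0 -> l = 0.
Proof.
move=> [r [s [N [c [d [d0 vr vs -> ->]]]]]] /eqP.
rewrite mulf_eq0 invr_eq0 (negbTE (transfer_den d0 vs)) orbF => /eqP ur.
by rewrite (kerP ur vr) mul0r.
Qed.

Lemma transfer_neq0 n z l : transfer n z l -> l != 0 -> z != 0.
Proof. by move=> zl; apply: contra_neq; apply: transfer_eq0 zl. Qed.

(** Degrees are natural numbers, so the dividend is taken in degree [n + m] instead of
    subtracting. *)
Lemma transfer_div n m z z' l l' : l' != 0 ->
  transfer (n + m) z l -> transfer m z' l' -> transfer n (z / z') (l / l').
Proof.
move=> l0 [r [s [N [c [d [d0 vr vs -> ->]]]]]] zl'; move: (zl') l0.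
move=> [r' [s' [N' [c' [d' [d0' vr' vs' zE ->]]]]]].
rewrite mulf_eq0 invr_eq0 (negbTE d0') orbF zE => c0'.
have [us us'] := (transfer_den d0 vs, transfer_den d0' vs').
have ur' := transfer_den c0' vr'.
exists (r * s'), (s * r'), (N + (m + N'))%N, (c * d'), (d * c').
split; first exact: mulf_neq0.
- rewrite rmorphM vr vs' -scalerAl -scalerAr -exprD scalerA.
  by rewrite [in RHS]addnA -!addnA; congr (_ *: 'X^(n + _)); rewrite addnCA.
- by rewrite rmorphM vs vr' -scalerAl -scalerAr -exprD scalerA.
- by rewrite !rmorphM; field; rewrite us us' ur'.
- by field; rewrite d0 d0' c0'.
Qed.

Lemma transfer_uniq n z l l' : transfer n z l -> transfer n z l' -> l = l'.
Proof.
move=> zl zl'; apply/eqP; rewrite -subr_eq0; apply/eqP.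
by apply: (transfer_eq0 (transferB zl zl')); rewrite subrr.
Qed.

End Transfer.

(** A common form for specialisations and for membership in a subfield. Division asks only for a
    divisor that is nonzero on the side of [L], as for a place. *)
Definition field_relation (K L : fieldType) (T : K -> L -> Prop) :=
  [/\ T 1 1, forall a b c d, T a c -> T b d -> T (a - b) (c - d),
      forall a b c d, T a c -> T b d -> T (a * b) (c * d)
    & forall a b c d, d != 0 -> T a c -> T b d -> T (a / b) (c / d)].

Lemma transfer_field (S : comNzRingType) (K L : fieldType)
    (u : {rmorphism S -> K}) (v : {rmorphism S -> {poly L}}) :
  monomial_kernel u v -> field_relation (transfer u v 0).
Proof.
move=> kerP; split.
- by rewrite -(rmorph1 u); apply: transfer_base; rewrite rmorph1 expr0 scale1r.
- by move=> a b c d; apply: transferB.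
- by move=> a b c d; apply: (transferM kerP).
- by move=> a b c d d0; apply: (transfer_div (n := 0%N) kerP).
Qed.

(** * Four points on a cubic *)

(* The normal form, scaled so that [alpha2 - alpha3 = 1]: [p] is
   [alpha3 - alpha1], the [qj] are the coordinates [beta_j], [(base_x, base_y)]
   is the first point, and [(pt_x alpha_j qj, pt_y alpha_j qj)] are the others.
   The value of [alpha3] solves the linear equation for the sum of the
   [alpha_j], that of [base_x] the linear equation between the indices 2 and 3. *)
Section Coordinates.
Variables (R : fieldType) (w p q1 q2 q3 : R).
Let theta := w ^+ 2 - w.

Definition alpha3 : R :=
  ((q1 ^+ 3 + p * q2 ^+ 3 - (1 + p) * q3 ^+ 3) / (p * (1 + p)) - 1 + p) / 3%:R.
Definition alpha2 : R := alpha3 + 1.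
Definition alpha1 : R := alpha3 - p.
Definition base_x : R :=
  (alpha3 ^+ 3 - alpha2 ^+ 3 + q2 ^+ 3 - q3 ^+ 3) * w ^+ 2 / 9%:R.
Definition base_y : R :=
  ((alpha3 ^+ 3 - q3 ^+ 3) / (3%:R * theta) + (w ^+ 2 - 1) * base_x * alpha3) / 2%:R.
Definition slope' (a q : R) : R := (a - q) / theta.
Definition slope (a q : R) : R := a - w ^+ 2 * slope' a q.
Definition pt_x (a q : R) : R := slope a q * slope' a q + w ^+ 2 * base_x.
Definition pt_y (a q : R) : R :=
  (slope a q * (pt_x a q - base_x) + slope' a q * (pt_x a q - w * base_x)) / 2%:R.

Hypotheses (hw : w ^+ 2 + w + 1 = 0) (n2 : 2%:R != 0 :> R) (n3 : 3%:R != 0 :> R).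
Hypotheses (p0 : p != 0) (p1 : 1 + p != 0).

Lemma w2E : w ^+ 2 = - w - 1.
Proof. by apply/eqP; rewrite -subr_eq0 -hw; apply/eqP; ring. Qed.

Lemma theta2 : theta ^+ 2 = - 3%:R.
Proof. rewrite /theta; ring: w2E. Qed.

Lemma theta_neq0 : theta != 0.
Proof.
apply: contra_neq n3 => th0.
by rewrite -[LHS]opprK -theta2 th0 expr0n oppr0.
Qed.

Lemma w_neq0 : w != 0.
Proof.
apply: contra_neq (oner_neq0 R) => w0.
by rewrite -hw w0 expr0n add0r add0r.
Qed.

(** In terms of [a] and [m = slope' a q] one has [q = a - theta * m], and [theta ^+ 2 = - 3%:R]
    makes the division of the difference of cubes by [3 theta] exact. What remains is a polynomial
    identity modulo [w ^+ 2 + w + 1]. *)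
Lemma slope_cubic a q x x' : x' = slope a q * slope' a q + w ^+ 2 * x ->
  slope a q * (x' - x) - slope' a q * (x' - w * x) =
  (a ^+ 3 - q ^+ 3) / (3%:R * theta) + (w ^+ 2 - 1) * x * a.
Proof.
have th0 := theta_neq0 => ->; rewrite /slope.
have qE : q = a - theta * slope' a q by rewrite /slope'; field.
move: (slope' a q) qE => m ->.
have -> : (a ^+ 3 - (a - theta * m) ^+ 3) / (3%:R * theta) =
    a ^+ 2 * m - a * theta * m ^+ 2 - m ^+ 3.
  apply: (mulIf (mulf_neq0 n3 th0)); rewrite divfK ?mulf_neq0 //.
  rewrite [LHS](_ : _ = theta * (3%:R * a ^+ 2 * m - 3%:R * a * theta * m ^+ 2
    + theta ^+ 2 * m ^+ 3)); first by rewrite theta2; ring.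
  ring.
rewrite /theta; ring: w2E.
Qed.

(** Twice the ordinate of the first point, as computed from one pair [(alpha_j, beta_j)]. *)
Definition cubic_value (a q : R) : R :=
  (a ^+ 3 - q ^+ 3) / (3%:R * theta) + (w ^+ 2 - 1) * base_x * a.

(* The conditions that [cubic_value] agrees at the [(aj, qj)] are linear in
   [alpha1 + alpha2 + alpha3] and [base_x]. *)
Lemma cubic_value2 : cubic_value alpha2 q2 = cubic_value alpha3 q3.
Proof.
have th0 := theta_neq0.
have n9 : 9%:R != 0 :> R by rewrite (natrM R 3 3) mulf_neq0.
have E : (w ^+ 2 - 1) * theta = 3%:R * w by rewrite /theta; ring: w2E.
have w3 : 3%:R * w * w ^+ 2 = 3%:R by ring: w2E.
rewrite /cubic_value /base_x; apply/eqP; rewrite -subr_eq0; apply/eqP.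
set c := alpha3 ^+ 3 - alpha2 ^+ 3 + q2 ^+ 3 - q3 ^+ 3.
have -> : (alpha2 ^+ 3 - q2 ^+ 3) / (3%:R * theta) + (w ^+ 2 - 1) * (c * w ^+ 2 / 9%:R) * alpha2
   - ((alpha3 ^+ 3 - q3 ^+ 3) / (3%:R * theta) + (w ^+ 2 - 1) * (c * w ^+ 2 / 9%:R) * alpha3)
  = c * ((w ^+ 2 - 1) * theta * w ^+ 2 - 3%:R) / (9%:R * theta).
  by rewrite /alpha2 /c /alpha2; field; rewrite n9 th0 n3.
by rewrite E w3 subrr mulr0 mul0r.
Qed.

(** The weights [1], [p], [- (1 + p)] are the differences [d_j]. They annihilate constants and the
    [alpha_j], so [base_x] drops out of the weighted sum and only the relation [rel] is left, which
    [alpha3] was chosen to solve. *)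
Lemma cubic_value1 : cubic_value alpha1 q1 = cubic_value alpha3 q3.
Proof.
have th0 := theta_neq0.
have n9 : 9%:R != 0 :> R by rewrite (natrM R 3 3) mulf_neq0.
have rel : alpha1 ^+ 3 + p * alpha2 ^+ 3 - (1 + p) * alpha3 ^+ 3 =
    q1 ^+ 3 + p * q2 ^+ 3 - (1 + p) * q3 ^+ 3.
  apply/eqP; rewrite -subr_eq0; apply/eqP.
  by rewrite /alpha1 /alpha2 /alpha3; field; rewrite n3 p0 p1.
have : cubic_value alpha1 q1 + p * cubic_value alpha2 q2 - (1 + p) * cubic_value alpha3 q3 = 0.
  rewrite /cubic_value -[RHS](mul0r (3%:R * theta)^-1).
  rewrite -(subrr (alpha1 ^+ 3 + p * alpha2 ^+ 3 - (1 + p) * alpha3 ^+ 3)) {2}rel.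
  by rewrite /alpha1 /alpha2; field; rewrite th0 n3.
rewrite cubic_value2 => /eqP; rewrite -addrA -mulrBl.
rewrite (_ : p - (1 + p) = -1); last by ring.
by rewrite mulN1r subr_eq0 => /eqP.
Qed.

Lemma base_yE a q : cubic_value a q = cubic_value alpha3 q3 ->
  slope a q * (pt_x a q - base_x) - slope' a q * (pt_x a q - w * base_x) = 2%:R * base_y.
Proof. by move=> qE; rewrite slope_cubic // -/(cubic_value a q) qE mulrC divfK. Qed.

(** The two ordinates are the half sum and half difference of [m (x - x0)] and [m' (x - w x0)], so
    their squares differ by the product of these. As [m m' = x - w^2 x0], this product is
    [x^3 - x0^3]. *)
Lemma pt_curve a q : cubic_value a q = cubic_value alpha3 q3 ->
  pt_y a q ^+ 2 - pt_x a q ^+ 3 = base_y ^+ 2 - base_x ^+ 3.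
Proof.
move=> /base_yE YE; have -> : base_y = (2%:R * base_y) / 2%:R by rewrite mulrAC mulfV ?mul1r.
rewrite -YE /pt_y.
have mE : slope a q * slope' a q = pt_x a q - w ^+ 2 * base_x by rewrite /pt_x; ring.
set m := slope a q in mE *; set m' := slope' a q in mE *; set x := pt_x a q in mE *.
have [E _] : ((m * (x - base_x) + m' * (x - w * base_x)) / 2%:R) ^+ 2 - x ^+ 3 -
   (((m * (x - base_x) - m' * (x - w * base_x)) / 2%:R) ^+ 2 - base_x ^+ 3) =
   (m * m') * (x - base_x) * (x - w * base_x) - x ^+ 3 + base_x ^+ 3 /\ True.
  by split=> //; field.
apply/eqP; rewrite -subr_eq0 E mE; apply/eqP; ring: w2E.
Qed.

Lemma slopeE a q : cubic_value a q = cubic_value alpha3 q3 -> pt_x a q != base_x ->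
  (pt_y a q + base_y) / (pt_x a q - base_x) = slope a q.
Proof.
move=> /base_yE YE; rewrite -subr_eq0 => x0.
have -> : base_y = (2%:R * base_y) / 2%:R by rewrite mulrAC mulfV ?mul1r.
by rewrite -YE /pt_y; field; rewrite n2 x0.
Qed.

Lemma slope'E a q : cubic_value a q = cubic_value alpha3 q3 -> pt_x a q != w * base_x ->
  (pt_y a q - base_y) / (pt_x a q - w * base_x) = slope' a q.
Proof.
move=> /base_yE YE; rewrite -subr_eq0 => x0.
have -> : base_y = (2%:R * base_y) / 2%:R by rewrite mulrAC mulfV ?mul1r.
by rewrite -YE /pt_y; field; rewrite n2 x0.
Qed.

Lemma slope_sum a q : slope a q + w ^+ 2 * slope' a q = a.
Proof. by rewrite /slope; ring. Qed.

Lemma slope_sum' a q : slope a q + w * slope' a q = q.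
Proof.
have th0 := theta_neq0.
have qE : q = a - theta * slope' a q by rewrite /slope'; field.
by rewrite /slope; move: (slope' a q) qE => m ->; rewrite /theta; ring.
Qed.

Lemma slope'_uniq m m' : slope' (m + w ^+ 2 * m') (m + w * m') = m'.
Proof.
by apply: (mulIf theta_neq0); rewrite /slope' divfK ?theta_neq0 // /theta; ring.
Qed.

Lemma slope_uniq m m' : slope (m + w ^+ 2 * m') (m + w * m') = m.
Proof. by rewrite /slope slope'_uniq addrK. Qed.

(** Converse of the cubic relations: the combination with weights [1], [p], [- (1 + p)] eliminates
    [c] and [x] and determines [A3]; the difference of the second and third equations then
    determines [x]. *)
Lemma normal_form_uniq A1 A2 A3 x c :
  A2 - A3 = 1 -> A3 - A1 = p ->
  (A1 ^+ 3 - q1 ^+ 3) / (3%:R * theta) + (w ^+ 2 - 1) * x * A1 = c ->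
  (A2 ^+ 3 - q2 ^+ 3) / (3%:R * theta) + (w ^+ 2 - 1) * x * A2 = c ->
  (A3 ^+ 3 - q3 ^+ 3) / (3%:R * theta) + (w ^+ 2 - 1) * x * A3 = c ->
  [/\ A1 = alpha1, A2 = alpha2, A3 = alpha3, x = base_x & c = 2%:R * base_y].
Proof.
have th0 := theta_neq0.
have n9 : 9%:R != 0 :> R by rewrite (natrM R 3 3) mulf_neq0.
move=> A23 A31 E1 E2 E3.
have A2E : A2 = A3 + 1 by rewrite -A23 addrC subrK.
have A1E : A1 = A3 - p by rewrite -A31; ring.
subst A1 A2.
have A3E : A3 = alpha3.
  have : c + p * c - (1 + p) * c = 0 by ring.
  rewrite -{1}E1 -{1}E2 -{1}E3 => E.
  have {}E : p * (1 + p) * (3%:R * A3 + 1 - p) =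
      q1 ^+ 3 + p * q2 ^+ 3 - (1 + p) * q3 ^+ 3.
    apply/eqP; rewrite -subr_eq0; apply/eqP.
    apply: (mulIf (invr_neq0 (mulf_neq0 n3 th0))); rewrite mul0r -E.
    by field; rewrite n3 th0.
  by rewrite /alpha3 -E; field; rewrite n3 p0 p1.
subst A3; have xE : x = base_x.
  have E : (w ^+ 2 - 1) * theta = 3%:R * w by rewrite /theta; ring: w2E.
  have : (w ^+ 2 - 1) * theta * x = (alpha3 ^+ 3 - (alpha3 + 1) ^+ 3 + q2 ^+ 3 - q3 ^+ 3) / 3%:R.
    have : c - c = 0 by ring.
    rewrite -{1}E2 -{1}E3 => {}E; apply/eqP; rewrite -subr_eq0; apply/eqP.
    apply: (mulIf (invr_neq0 th0)); rewrite mul0r -E.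
    by field; rewrite n3 th0.
  rewrite {}E -/alpha2 => xE; apply: (mulfI (mulf_neq0 n3 w_neq0)); rewrite xE /base_x.
  have w3 : w ^+ 2 * w = 1 by ring: w2E.
  set d := _ - q3 ^+ 3.
  rewrite (_ : 3%:R * w * (d * w ^+ 2 / 9%:R) = d * (w ^+ 2 * w) * 3%:R / 9%:R).
    by rewrite w3; field; rewrite n3 n9.
  by ring.
split=> //; rewrite /base_y mulrC divfK // -xE -E3 //.
Qed.

End Coordinates.

(** * The two slopes attached to a pair of points *)

Section PointSlopes.
Variables (R : fieldType) (w x0 y0 x y : R).
Hypotheses (hw : w ^+ 2 + w + 1 = 0) (n2 : 2%:R != 0 :> R) (n3 : 3%:R != 0 :> R).
Hypotheses (xx0 : x - x0 != 0) (xwx0 : x - w * x0 != 0).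
Hypothesis curve : y ^+ 2 - x ^+ 3 = y0 ^+ 2 - x0 ^+ 3.

Definition slope_of : R := (y + y0) / (x - x0).
Definition slope'_of : R := (y - y0) / (x - w * x0).

(** On a common twist [y^2 - y0^2 = x^3 - x0^3], and the two denominators cancel two of its three
    linear factors. *)
Lemma slope_ofM : x = slope_of * slope'_of + w ^+ 2 * x0.
Proof.
have w2 := w2E hw; apply/eqP; rewrite -subr_eq; apply/eqP.
apply: (mulIf (mulf_neq0 xx0 xwx0)); rewrite /slope_of /slope'_of.
have -> : (y + y0) / (x - x0) * ((y - y0) / (x - w * x0)) *
    ((x - x0) * (x - w * x0)) = y ^+ 2 - y0 ^+ 2 by field; rewrite xx0 xwx0.
have -> : y ^+ 2 - y0 ^+ 2 = x ^+ 3 - x0 ^+ 3.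
  by apply/eqP; rewrite -subr_eq0 -(subrr (y ^+ 2 - x ^+ 3)) {2}curve; apply/eqP; ring.
ring: w2.
Qed.

Lemma slope_ofB : slope_of * (x - x0) - slope'_of * (x - w * x0) = 2%:R * y0.
Proof. by rewrite /slope_of /slope'_of; field; rewrite xx0 xwx0. Qed.

Lemma slope_ofD : slope_of * (x - x0) + slope'_of * (x - w * x0) = 2%:R * y.
Proof. by rewrite /slope_of /slope'_of; field; rewrite xx0 xwx0. Qed.

End PointSlopes.

(** * The parametrization of normalised quadruples of points *)

Section Parametrization.
Variables (R : fieldType) (w : R) (t : 'I_4 -> R).

Definition par_q (j : 'I_3) : R := t (lift ord0 j).
Notation q1 := (par_q (@Ordinal 3 0 isT)).
Notation q2 := (par_q (@Ordinal 3 1 isT)).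
Notation q3 := (par_q (@Ordinal 3 2 isT)).
Definition par_a (j : 'I_3) : R :=
  nth 0 [:: alpha1 (t ord0) q1 q2 q3; alpha2 (t ord0) q1 q2 q3; alpha3 (t ord0) q1 q2 q3] j.
Definition par_x0 : R := base_x w (t ord0) q1 q2 q3.
Definition par_y0 : R := base_y w (t ord0) q1 q2 q3.
Definition par_x (i : 'I_4) : R :=
  if unlift ord0 i is Some j then pt_x w (t ord0) q1 q2 q3 (par_a j) (par_q j)
  else par_x0.
Definition par_y (i : 'I_4) : R :=
  if unlift ord0 i is Some j then pt_y w (t ord0) q1 q2 q3 (par_a j) (par_q j)
  else par_y0.

Lemma par_x_0 : par_x ord0 = par_x0.
Proof. by rewrite /par_x unlift_none. Qed.

Lemma par_y_0 : par_y ord0 = par_y0.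
Proof. by rewrite /par_y unlift_none. Qed.

Lemma par_x_lift j :
  par_x (lift ord0 j) = slope w (par_a j) (par_q j) * slope' w (par_a j) (par_q j)
    + w ^+ 2 * par_x0.
Proof. by rewrite /par_x liftK. Qed.

Lemma par_y_lift j : par_y (lift ord0 j) =
  (slope w (par_a j) (par_q j) * (par_x (lift ord0 j) - par_x0) +
   slope' w (par_a j) (par_q j) * (par_x (lift ord0 j) - w * par_x0)) / 2%:R.
Proof. by rewrite /par_y /par_x liftK. Qed.

Lemma ord3_ind (P : 'I_3 -> Prop) : P (@Ordinal 3 0 isT) ->
  P (@Ordinal 3 1 isT) -> P (@Ordinal 3 2 isT) -> forall j, P j.
Proof.
move=> P0 P1 P2 [[|[|[|//]]] lt_j].
- by rewrite (_ : Ordinal lt_j = Ordinal (isT : 0 < 3)%N) //; apply: val_inj.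
- by rewrite (_ : Ordinal lt_j = Ordinal (isT : 1 < 3)%N) //; apply: val_inj.
- by rewrite (_ : Ordinal lt_j = Ordinal (isT : 2 < 3)%N) //; apply: val_inj.
Qed.

Hypotheses (hw : w ^+ 2 + w + 1 = 0) (n2 : 2%:R != 0 :> R) (n3 : 3%:R != 0 :> R).
Hypotheses (p0 : t ord0 != 0) (p1 : 1 + t ord0 != 0).

Lemma par_cubic j : cubic_value w (t ord0) q1 q2 q3 (par_a j) (par_q j) =
  cubic_value w (t ord0) q1 q2 q3 (par_a (@Ordinal 3 2 isT)) q3.
Proof.
by elim/ord3_ind: j; [apply: cubic_value1|apply: cubic_value2|].
Qed.

Lemma par_curve i : par_y i ^+ 2 - par_x i ^+ 3 = par_y0 ^+ 2 - par_x0 ^+ 3.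
Proof.
have [j ->|->] := unliftP ord0 i; last by rewrite par_x_0 par_y_0.
by rewrite /par_x /par_y liftK; apply: pt_curve => //; apply: par_cubic.
Qed.

Lemma par_slope j : par_x (lift ord0 j) - par_x0 != 0 ->
  slope_of par_x0 par_y0 (par_x (lift ord0 j)) (par_y (lift ord0 j)) =
    slope w (par_a j) (par_q j).
Proof.
rewrite subr_eq0 /par_x /par_y liftK => x0.
by apply: slopeE => //; apply: par_cubic.
Qed.

Lemma par_slope' j : par_x (lift ord0 j) - w * par_x0 != 0 ->
  slope'_of w par_x0 par_y0 (par_x (lift ord0 j)) (par_y (lift ord0 j)) =
    slope' w (par_a j) (par_q j).
Proof.
rewrite subr_eq0 /par_x /par_y liftK => x0.
by apply: slope'E => //; apply: par_cubic.
Qed.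

(** This makes the coordinates faithful. Each slope pair yields a cubic equation, [normal_form_uniq]
    recovers the [a j] and the first point, and [a j] together with [t (lift ord0 j)] gives back
    both slopes, hence the other points. *)
Lemma par_uniq (x y : 'I_4 -> R) (m m' : 'I_3 -> R) :
  (forall i, y i ^+ 2 - x i ^+ 3 = y ord0 ^+ 2 - x ord0 ^+ 3) ->
  (forall j, x (lift ord0 j) - x ord0 != 0) ->
  (forall j, x (lift ord0 j) - w * x ord0 != 0) ->
  (forall j, m j = slope_of (x ord0) (y ord0) (x (lift ord0 j)) (y (lift ord0 j))) ->
  (forall j, m' j = slope'_of w (x ord0) (y ord0) (x (lift ord0 j)) (y (lift ord0 j))) ->
  let a j := m j + w ^+ 2 * m' j in
  a (@Ordinal 3 1 isT) - a (@Ordinal 3 2 isT) = 1 ->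
  a (@Ordinal 3 2 isT) - a (@Ordinal 3 0 isT) = t ord0 ->
  (forall j, m j + w * m' j = t (lift ord0 j)) ->
  x =1 par_x /\ y =1 par_y.
Proof.
move=> xy xx0 xwx0 mE m'E a a12 a20 bE.
have cubicE j : (a j ^+ 3 - par_q j ^+ 3) / (3%:R * (w ^+ 2 - w)) +
    (w ^+ 2 - 1) * x ord0 * a j = 2%:R * y ord0.
  rewrite /par_q -bE.
  rewrite -(@slope_cubic _ w hw n3 _ _ (x ord0) (x (lift ord0 j))).
    by rewrite slope_uniq // slope'_uniq // mE m'E; apply: slope_ofB.
  by rewrite slope_uniq // slope'_uniq // mE m'E; apply: slope_ofM.
have [] := normal_form_uniq hw n2 n3 p0 p1 a12 a20 (cubicE _) (cubicE _) (cubicE _).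
move=> A1 A2 A3 x0E /(mulfI n2) y0E.
have aE j : a j = par_a j by elim/ord3_ind: j.
have slE j : slope w (par_a j) (par_q j) = m j /\ slope' w (par_a j) (par_q j) = m' j.
  by rewrite -aE /par_q -bE slope_uniq // slope'_uniq.
have xE i : x i = par_x i.
  have [j ->|->] := unliftP ord0 i; last by rewrite par_x_0.
  have [sE s'E] := slE j; rewrite par_x_lift sE s'E mE m'E /par_x0 -x0E.
  exact: slope_ofM.
split=> // i; have [j ->|->] := unliftP ord0 i; last by rewrite par_y_0.
have [sE s'E] := slE j; rewrite par_y_lift sE s'E mE m'E -xE /par_x0 -x0E.
by rewrite slope_ofD // mulrC mulKf.
Qed.

End Parametrization.

(** * Compatibility of the parametrization with specialisations *)

Section FieldRelation.
Variables (K L : fieldType) (T : K -> L -> Prop).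
Hypothesis relT : field_relation T.

Lemma frel1 : T 1 1. Proof. by case: relT. Qed.

Lemma frelB a b c d : T a c -> T b d -> T (a - b) (c - d).
Proof. by case: relT => _ TB _ _; apply: TB. Qed.

Lemma frelM a b c d : T a c -> T b d -> T (a * b) (c * d).
Proof. by case: relT => _ _ TM _; apply: TM. Qed.

Lemma frel_div a b c d : d != 0 -> T a c -> T b d -> T (a / b) (c / d).
Proof. by case: relT => _ _ _; apply. Qed.

Lemma frel0 : T 0 0.
Proof. by have := frelB frel1 frel1; rewrite !subrr. Qed.

Lemma frelD a b c d : T a c -> T b d -> T (a + b) (c + d).
Proof.
move=> Tac Tbd; rewrite -[b]opprK -[d]opprK -[- b]add0r -[- d]add0r.
by apply: frelB => //; apply: frelB => //; apply: frel0.
Qed.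

Lemma frelX a c n : T a c -> T (a ^+ n) (c ^+ n).
Proof.
move=> Tac; elim: n => [|n IHn]; first by rewrite !expr0; apply: frel1.
by rewrite !exprS; apply: frelM.
Qed.

Lemma frel_nat n : T n%:R n%:R.
Proof.
by elim: n => [|n IHn]; [apply: frel0|rewrite -!natr1; apply: frelD => //; apply: frel1].
Qed.

Variables (w : K) (w' : L) (t : 'I_4 -> K) (t' : 'I_4 -> L).
Hypotheses (Tw : T w w') (Tt : forall i, T (t i) (t' i)).
Hypotheses (hw : w' ^+ 2 + w' + 1 = 0).
Hypotheses (n2 : 2%:R != 0 :> L) (n3 : 3%:R != 0 :> L).
Hypotheses (p0 : t' ord0 != 0) (p1 : 1 + t' ord0 != 0).

Let n9 : 9%:R != 0 :> L. Proof. by rewrite (natrM L 3 3) mulf_neq0. Qed.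
Let th0 := theta_neq0 hw n3.

(** Follows the syntax of a formula. Quotients are tried before products because [a / b] is itself a
    product, and [T] has no rule for a bare inverse. *)
Ltac frel := repeat first
  [ exact: Tw | exact: Tt | exact: frel1 | exact: frel_nat
  | apply: frelB | apply: frelD | apply: frelX
  | apply: frel_div; [solve [by rewrite ?mulf_neq0]| |] | apply: frelM ].

Lemma frel_a j : T (par_a t j) (par_a t' j).
Proof. by elim/ord3_ind: j; rewrite /par_a /= /alpha1 /alpha2 /alpha3 /par_q; frel. Qed.

Lemma frel_x0 : T (par_x0 w t) (par_x0 w' t').
Proof. by rewrite /par_x0 /base_x /alpha2 /alpha3 /par_q; frel. Qed.

Lemma frel_x i : T (par_x w t i) (par_x w' t' i).
Proof.
have [j ->|->] := unliftP ord0 i; last by rewrite !par_x_0; apply: frel_x0.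
have Ta := frel_a j; have Tx := frel_x0; rewrite !par_x_lift.
move: (par_a _ _) (par_a _ _) (par_x0 _ _) (par_x0 _ _) Ta Tx => a c x x' Ta Tx.
by rewrite /slope /slope' /par_q; repeat first [exact: Ta|exact: Tx|progress frel].
Qed.

Lemma frel_y i : T (par_y w t i) (par_y w' t' i).
Proof.
have [j ->|->] := unliftP ord0 i; last first.
  have Ta := frel_a (@Ordinal 3 2 isT); have Tx := frel_x0.
  rewrite !par_y_0 /par_y0 /base_y -!/(par_x0 _ _).
  rewrite -!/(par_a _ (@Ordinal 3 2 isT)).
  move: (par_a _ _) (par_a _ _) (par_x0 _ _) (par_x0 _ _) Ta Tx => a c x x' Ta Tx.
  by rewrite /par_q; repeat first [exact: Ta|exact: Tx|progress frel].
have Ta := frel_a j; have Tx := frel_x0; have Txj := frel_x (lift ord0 j).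
rewrite !par_y_lift.
move: (par_x _ _ _) (par_x _ _ _) Txj => y y' Ty.
move: (par_a _ _) (par_a _ _) (par_x0 _ _) (par_x0 _ _) Ta Tx => a c x x' Ta Tx.
rewrite /slope /slope' /par_q.
by repeat first [exact: Ta|exact: Tx|exact: Ty|progress frel].
Qed.

End FieldRelation.

Lemma rmorphism_of_relation (K L : fieldType) (T : K -> L -> Prop) :
  field_relation T -> (forall z, exists l, T z l) ->
  (forall z l l', T z l -> T z l' -> l = l') ->
  exists phi : {rmorphism K -> L}, forall z, T z (phi z).
Proof.
move=> relT ex uniqT; pose phi z := sval (cid (ex z)).
have phiP z : T z (phi z) by rewrite /phi; case: cid.
have phiB : zmod_morphism phi.
  by move=> a b; apply: (uniqT (a - b)) => //; apply: (frelB relT).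
have phiM : monoid_morphism phi.
  split; first by apply: (uniqT 1) => //; apply: (frel1 relT).
  by move=> a b; apply: (uniqT (a * b)) => //; apply: (frelM relT).
pose zM := GRing.isZmodMorphism.Build K L phi phiB.
pose mM := GRing.isMonoidMorphism.Build K L phi phiM.
pose f : {rmorphism K -> L} := HB.pack phi zM mM.
by exists f.
Qed.

(** * Nonvanishing for indeterminate coordinates, by specialisation *)

Section UniversalPoint.
Variables (k : fieldType) (w : k).
Hypotheses (hw : w ^+ 2 + w + 1 = 0) (n2 : 2%:R != 0 :> k) (n3 : 3%:R != 0 :> k).

Local Notation S := {mpoly k[4]}.
Local Notation L := {fraction S}.

Definition univ_const : {rmorphism k -> L} := @tofrac _ \o @mpolyC 4 k.
Definition univ_t (i : 'I_4) : L := tofrac 'X_i.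
(* At this point the normalised slopes of the three moving points are
   [-1, 1, 0], and the discriminant is [1 / 729]. *)
Definition special_point (i : 'I_4) : k := (i == ord0)%:R.

(** Followed by [polyC], evaluation at the special point becomes a case of [transfer] in degree 0; a
    rational function with a nonzero value there is nonzero. *)
Let ev : {rmorphism S -> {poly k}} := polyC \o mmap idfun special_point.

Let ev_kernel : monomial_kernel (@tofrac S) ev.
Proof.
move=> r c n /eqP; rewrite tofrac_eq0 => /eqP->; rewrite rmorph0 => /esym/eqP.
by rewrite scaler_eq0 -size_poly_eq0 size_polyXn orbF => /eqP.
Qed.

Let T := transfer (@tofrac S) ev 0.
Let relT : field_relation T := transfer_field ev_kernel.

Let ev_const c : T (univ_const c) c.
Proof.
by apply: (transfer_base (@tofrac S)); rewrite expr0 alg_polyC /= mmapC.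
Qed.

Let ev_t i : T (univ_t i) (special_point i).
Proof.
by apply: (transfer_base (@tofrac S)); rewrite expr0 alg_polyC /= mmapX mmap1U.
Qed.

Let T_neq0 z c : T z c -> c != 0 -> z != 0.
Proof. exact: (transfer_neq0 ev_kernel). Qed.

Lemma univ_t0_neq0 : univ_t ord0 != 0.
Proof. by apply: (T_neq0 (ev_t ord0)); rewrite /special_point eqxx oner_eq0. Qed.

Lemma univ_t1_neq0 : 1 + univ_t ord0 != 0.
Proof.
by apply: (T_neq0 (frelD relT (frel1 relT) (ev_t ord0))); rewrite /special_point eqxx.
Qed.

Let s0 : special_point ord0 != 0. Proof. exact: oner_neq0. Qed.
Let s1 : 1 + special_point ord0 != 0. Proof. by []. Qed.

Let th0 : w ^+ 2 - w != 0 := theta_neq0 hw n3.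
Let w2 : w ^+ 2 = - w - 1 := w2E hw.
Let w0 : w != 0 := w_neq0 hw.
Let n9 : 9%:R != 0 :> k. Proof. by rewrite (natrM k 3 3) mulf_neq0. Qed.

Let special_a j : par_a special_point j = nth 0 [:: -1; 1; 0] j.
Proof.
have sE : special_point ord0 = 1 by rewrite /special_point eqxx.
elim/ord3_ind: j; rewrite /par_a /alpha1 /alpha2 /alpha3 sE /par_q /special_point /=.
- by field; rewrite n2 n3.
- by field; rewrite n2 n3.
- by field; rewrite n2 n3.
Qed.

Let special_q j : par_q special_point j = 0.
Proof. by []. Qed.

Let special_a3 : alpha3 (special_point ord0) 0 0 0 = 0.
Proof. by have := special_a (@Ordinal 3 2 isT); rewrite /par_a /= !special_q. Qed.

Let special_x0 : par_x0 w special_point = - w ^+ 2 / 9%:R.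
Proof.
by rewrite /par_x0 /base_x !special_q /alpha2 special_a3; field.
Qed.

Let special_y0 : par_y0 w special_point = 0.
Proof.
by rewrite /par_y0 /base_y !special_q special_a3 expr0n mulr0 subrr mul0r addr0 mul0r.
Qed.

Let special_xj (j : 'I_3) : par_x w special_point (lift ord0 j) =
  (if j == @Ordinal 3 2 isT then 0 else w / 3%:R) - w / 9%:R.
Proof.
have slopeM a : slope w a 0 * slope' w a 0 = a ^+ 2 * (w / 3%:R).
  have [th [thE thn0 th2]] :
      exists th, [/\ th = w ^+ 2 - w, th != 0 & th ^+ 2 = - 3%:R].
    by exists (w ^+ 2 - w); split=> //; apply: theta2.
  rewrite /slope /slope' !subr0 -thE.
  apply: (mulIf (expf_neq0 2 thn0)).
  have -> : (a - w ^+ 2 * (a / th)) * (a / th) * th ^+ 2 =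
    a ^+ 2 * (th - w ^+ 2) by field.
  have -> : th - w ^+ 2 = - w by rewrite thE; ring.
  by rewrite th2; field.
rewrite par_x_lift special_q special_x0 slopeM special_a.
have -> : w ^+ 2 * (- w ^+ 2 / 9%:R) = - (w / 9%:R).
  rewrite mulNr mulrN mulrA; congr (- (_ / _)); ring: w2.
congr (_ - _).
by elim/ord3_ind: j; rewrite //= ?sqrrN expr1n mul1r || rewrite expr0n mul0r.
Qed.

(** Here and in [univ_wx_neq0] the value at the special point is [theta / 9] up to sign and a power
    of [w]. *)
Lemma univ_x_neq0 j :
  par_x (univ_const w) univ_t (lift ord0 j) - par_x0 (univ_const w) univ_t != 0.
Proof.
have := T_neq0 (frelB relT (frel_x relT (ev_const w) ev_t hw n3 s0 s1 (lift ord0 j))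
  (frel_x0 relT (ev_const w) ev_t n3 s0 s1)); apply.
rewrite special_xj special_x0; case: ifP => _.
  have -> : 0 - w / 9%:R - - w ^+ 2 / 9%:R = (w ^+ 2 - w) / 9%:R by ring.
  by rewrite mulf_neq0 ?invr_neq0.
have -> : w / 3%:R - w / 9%:R - - w ^+ 2 / 9%:R = (w ^+ 2 + 2%:R * w) / 9%:R.
  by field; rewrite n3 n9.
have -> : w ^+ 2 + 2%:R * w = (w ^+ 2 - w) * w ^+ 2 by ring: w2.
by rewrite !mulf_neq0 ?expf_neq0 ?invr_neq0.
Qed.

Lemma univ_wx_neq0 j :
  par_x (univ_const w) univ_t (lift ord0 j) -
    univ_const w * par_x0 (univ_const w) univ_t != 0.
Proof.
have := T_neq0 (frelB relT (frel_x relT (ev_const w) ev_t hw n3 s0 s1 (lift ord0 j))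
  (frelM relT (ev_const w) (frel_x0 relT (ev_const w) ev_t n3 s0 s1))); apply.
rewrite special_xj special_x0; case: ifP => _.
  have -> : 0 - w / 9%:R - w * (- w ^+ 2 / 9%:R) = (1 - w) / 9%:R by ring: w2.
  have w1 : 1 - w = - ((w ^+ 2 - w) * w ^+ 2) by ring: w2.
  by rewrite w1 mulf_neq0 ?invr_neq0 // oppr_eq0 mulf_neq0 ?expf_neq0.
have -> : w / 3%:R - w / 9%:R - w * (- w ^+ 2 / 9%:R) = (2%:R * w + w ^+ 3) / 9%:R.
  by field; rewrite n3 n9.
have -> : 2%:R * w + w ^+ 3 = w - w ^+ 2 by ring: w2.
by rewrite mulf_neq0 ?invr_neq0 // -opprB oppr_eq0.
Qed.

Lemma univ_disc_neq0 :
  par_y0 (univ_const w) univ_t ^+ 2 - par_x0 (univ_const w) univ_t ^+ 3 != 0.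
Proof.
have Ty := frel_y relT (ev_const w) ev_t hw n2 n3 s0 s1 ord0.
have Tx := frel_x relT (ev_const w) ev_t hw n3 s0 s1 ord0.
rewrite !par_y_0 in Ty; rewrite !par_x_0 in Tx.
have := T_neq0 (frelB relT (frelX relT 2 Ty) (frelX relT 3 Tx)); apply.
rewrite special_x0 special_y0 expr0n sub0r oppr_eq0.
by rewrite expf_neq0 // mulf_neq0 ?invr_neq0 // oppr_eq0 expf_neq0.
Qed.

End UniversalPoint.

(** * The function field of the quotient *)

Section E6Coordinates.
Variables (k : fieldType) (w : k) (K : E6_power_field k 4).
Hypotheses (hw : w ^+ 2 + w + 1 = 0) (n2 : 2%:R != 0 :> k) (n3 : 3%:R != 0 :> k).

Variables (L : fieldType) (cL : {rmorphism k -> L}) (tL : 'I_4 -> L).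
Hypotheses (t0L : tL ord0 != 0) (t1L : 1 + tL ord0 != 0).
Hypotheses (xL : forall j, par_x (cL w) tL (lift ord0 j) - par_x0 (cL w) tL != 0)
  (wxL : forall j,
     par_x (cL w) tL (lift ord0 j) - cL w * par_x0 (cL w) tL != 0)
  (discL : par_y0 (cL w) tL ^+ 2 - par_x0 (cL w) tL ^+ 3 != 0).

Local Notation cK := (E6_const K).
Local Notation x := (E6_x K).
Local Notation y := (E6_y K).
Local Notation X := (par_x (cL w) tL).
Local Notation Y := (par_y (cL w) tL).

Let hwL : cL w ^+ 2 + cL w + 1 = 0.
Proof. by rewrite -rmorphXn -rmorphD -(rmorph1 cL) -rmorphD hw rmorph0. Qed.
Let n2L : 2%:R != 0 :> L. Proof. by rewrite -(rmorph_nat cL) fmorph_eq0. Qed.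
Let n3L : 3%:R != 0 :> L. Proof. by rewrite -(rmorph_nat cL) fmorph_eq0. Qed.
Let hwK : cK w ^+ 2 + cK w + 1 = 0.
Proof. by rewrite -rmorphXn -rmorphD -(rmorph1 cK) -rmorphD hw rmorph0. Qed.
Let n2K : 2%:R != 0 :> K. Proof. by rewrite -(rmorph_nat cK) fmorph_eq0. Qed.
Let n3K : 3%:R != 0 :> K. Proof. by rewrite -(rmorph_nat cK) fmorph_eq0. Qed.

Definition E6_coord (j : 'I_(4 + 4)) : K :=
  match split j with inl i => x i | inr i => y i end.
(** The variable ['X] stands for the scale [e], with weight 2 on abscissas and 3 on ordinates. The
    parametrized point lies on a twist [y^2 = x^3 + D]; the weights avoid adjoining to [L] a sixth
    root of [- 1 / D] to bring it to E(6). *)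
Definition univ_coord (j : 'I_(4 + 4)) : {poly L} :=
  match split j with inl i => X i *: 'X^2 | inr i => Y i *: 'X^3 end.

Definition E6_ev : {rmorphism {mpoly k[4 + 4]} -> K} := mmap cK E6_coord.
Definition univ_ev : {rmorphism {mpoly k[4 + 4]} -> {poly L}} :=
  mmap (polyC \o cL) univ_coord.

Lemma E6_ev_x i : E6_ev 'X_(lshift 4 i) = x i.
Proof. by rewrite /E6_ev /= mmapX mmap1U /E6_coord (unsplitK (inl i)). Qed.
Lemma E6_ev_y i : E6_ev 'X_(rshift 4 i) = y i.
Proof. by rewrite /E6_ev /= mmapX mmap1U /E6_coord (unsplitK (inr i)). Qed.
Lemma univ_ev_x i : univ_ev 'X_(lshift 4 i) = X i *: 'X^2.
Proof. by rewrite /univ_ev /= mmapX mmap1U /univ_coord (unsplitK (inl i)). Qed.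
Lemma univ_ev_y i : univ_ev 'X_(rshift 4 i) = Y i *: 'X^3.
Proof. by rewrite /univ_ev /= mmapX mmap1U /univ_coord (unsplitK (inr i)). Qed.

Lemma E6_curve i : y i ^+ 2 = x i ^+ 3 - 1.
Proof.
have [_ rel] := @E6_relations _ _ K ('X_(rshift 4 i) ^+ 2 - 'X_(lshift 4 i) ^+ 3 + 1).
have /rel : exists q : 'I_4 -> {mpoly k[4 + 4]},
    'X_(rshift 4 i) ^+ 2 - 'X_(lshift 4 i) ^+ 3 + 1 =
    \sum_j q j * ('X_(rshift 4 j) ^+ 2 - 'X_(lshift 4 j) ^+ 3 + 1).
  exists (fun j => (j == i)%:R); rewrite (bigD1 i) //= eqxx mul1r big1 ?addr0 //.
  by move=> j /negPf->; rewrite mul0r.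
rewrite -[E6_eval _ _ _ _]/(E6_ev _) rmorphD rmorphB !rmorphXn rmorph1.
rewrite E6_ev_x E6_ev_y => E; apply/eqP; rewrite -subr_eq0; apply/eqP.
by rewrite -[RHS]E; ring.
Qed.

Lemma univ_curve i : Y i ^+ 2 - X i ^+ 3 =
  par_y0 (cL w) tL ^+ 2 - par_x0 (cL w) tL ^+ 3.
Proof. exact: (par_curve hwL n2L n3L t0L t1L). Qed.

(* [E6_ev] has its kernel generated by the equations of the four curves, which
   [univ_ev] sends to multiples of [D 'X^6 + 1], a polynomial prime to ['X]. *)
Lemma E6_ev_kernel : monomial_kernel E6_ev univ_ev.
Proof.
move=> r c n ur0 vr; apply/eqP/negPn/negP => c0.
have [/(_ ur0)[q rE] _] := @E6_relations _ _ K r.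
set D := par_y0 (cL w) tL ^+ 2 - par_x0 (cL w) tL ^+ 3.
have D0 : D != 0 by [].
pose P := D *: 'X^6 + 1.
have szP : size P = 7.
  by rewrite size_polyDl size_scale ?size_polyXn ?size_poly1.
have PE i : univ_ev ('X_(rshift 4 i) ^+ 2 - 'X_(lshift 4 i) ^+ 3 + 1) = P.
  rewrite rmorphD rmorphB !rmorphXn rmorph1 univ_ev_x univ_ev_y.
  by rewrite !exprZn -!exprM -scalerBl univ_curve.
have : P %| c *: 'X^n.
  rewrite -vr rE rmorph_sum; apply: (big_ind (fun p => P %| p)) => [|p p' dp dp'|i _].
  - exact: dvdp0.
  - exact: dvdp_add.
  - by rewrite rmorphM PE dvdp_mull.
rewrite dvdpZr // => dvdP.
have copX : coprimep P 'X^n.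
  apply: coprimep_expr; rewrite coprimepX /root /P hornerD hornerZ hornerXn.
  by rewrite expr0n mulr0 add0r hornerC oner_eq0.
by have := coprimep_dvdl dvdP copX; rewrite coprimepp szP.
Qed.

Let T := transfer E6_ev univ_ev.

Lemma E6_transfer_const c : T 0 (cK c) (cL c).
Proof.
rewrite -[cK c](mmapC E6_coord cK); apply: (transfer_base E6_ev).
by rewrite /univ_ev /= mmapC expr0 alg_polyC.
Qed.

Let T_x i : T 2 (x i) (X i).
Proof. by rewrite -E6_ev_x; exact: (transfer_base _ (univ_ev_x i)). Qed.

Let T_y i : T 3 (y i) (Y i).
Proof. by rewrite -E6_ev_y; exact: (transfer_base _ (univ_ev_y i)). Qed.

Let TB := transferB E6_ev_kernel.
Let TM := transferM E6_ev_kernel.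
Let T_neq0 := transfer_neq0 E6_ev_kernel.

Let TN n z l : T n z l -> T n (- z) (- l).
Proof.
move=> zl; have := TB (TB zl zl) zl.
by rewrite !subrr !sub0r.
Qed.

Let TD n z l z' l' : T n z l -> T n z' l' -> T n (z + z') (l + l').
Proof. by move=> zl zl'; rewrite -[z']opprK -[l']opprK; apply: TB => //; apply: TN. Qed.

Definition E6_slope (j : 'I_3) : K :=
  slope_of (x ord0) (y ord0) (x (lift ord0 j)) (y (lift ord0 j)).
Definition E6_slope' (j : 'I_3) : K :=
  slope'_of (cK w) (x ord0) (y ord0) (x (lift ord0 j)) (y (lift ord0 j)).
Definition E6_alpha (j : 'I_3) : K := E6_slope j + cK w ^+ 2 * E6_slope' j.
Definition E6_beta (j : 'I_3) : K := E6_slope j + cK w * E6_slope' j.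
Definition E6_scale : K :=
  E6_alpha (@Ordinal 3 1 isT) - E6_alpha (@Ordinal 3 2 isT).
(* The functions [(alpha_3 - alpha_1) / e, beta_1 / e, beta_2 / e, beta_3 / e],
   [e] being [E6_scale]: the coordinates that identify [E(6)^4 / g6] with an
   affine space. *)
Definition E6_t (i : 'I_4) : K :=
  (if unlift ord0 i is Some j then E6_beta j
   else E6_alpha (@Ordinal 3 2 isT) - E6_alpha (@Ordinal 3 0 isT)) / E6_scale.

Let T_xB j : T 2 (x (lift ord0 j) - x ord0) (X (lift ord0 j) - par_x0 (cL w) tL).
Proof. by rewrite -[par_x0 _ _]par_x_0; apply: TB; apply: T_x. Qed.

Let T_xwB j : T 2 (x (lift ord0 j) - cK w * x ord0)
  (X (lift ord0 j) - cL w * par_x0 (cL w) tL).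
Proof.
rewrite -[par_x0 _ _]par_x_0; apply: TB; first exact: T_x.
exact: (TM (E6_transfer_const w) (T_x ord0)).
Qed.

(** Nonvanishing of functions on E(6)^4 is deduced, here and below, from that of their transfers to
    [L]. *)
Lemma E6_xB_neq0 j : x (lift ord0 j) - x ord0 != 0.
Proof. by apply: T_neq0 (T_xB j) _; apply: xL. Qed.

Lemma E6_xwB_neq0 j : x (lift ord0 j) - cK w * x ord0 != 0.
Proof. by apply: T_neq0 (T_xwB j) _; apply: wxL. Qed.

Let T_slope j : T 1 (E6_slope j) (slope (cL w) (par_a tL j) (par_q tL j)).
Proof.
rewrite -(par_slope hwL n2L n3L t0L t1L (xL j)).
apply: (transfer_div (n := 1) (m := 2) E6_ev_kernel (xL j) _ (T_xB j)).
by rewrite -par_y_0; apply: TD; apply: T_y.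
Qed.

Let T_slope' j : T 1 (E6_slope' j) (slope' (cL w) (par_a tL j) (par_q tL j)).
Proof.
rewrite -(par_slope' hwL n2L n3L t0L t1L (wxL j)).
apply: (transfer_div (n := 1) (m := 2) E6_ev_kernel (wxL j) _ (T_xwB j)).
by rewrite -par_y_0; apply: TB; apply: T_y.
Qed.

Let T_alpha j : T 1 (E6_alpha j) (par_a tL j).
Proof.
rewrite -(slope_sum (cL w) (par_a _ j) (par_q tL j)); apply: TD; first exact: T_slope.
rewrite -!rmorphXn; exact: (TM (E6_transfer_const _) (T_slope' j)).
Qed.

Let T_beta j : T 1 (E6_beta j) (tL (lift ord0 j)).
Proof.
rewrite -[tL _](@slope_sum' _ (cL w) hwL n3L (par_a tL j)).
by apply: TD; [apply: T_slope|apply: (TM (E6_transfer_const w) (T_slope' j))].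
Qed.

Let T_scale : T 1 E6_scale 1.
Proof.
suff <- : par_a tL (@Ordinal 3 1 isT) - par_a tL (@Ordinal 3 2 isT) = 1.
  by apply: TB; apply: T_alpha.
by rewrite /par_a /= /alpha2 addrC addKr.
Qed.

Lemma E6_scale_neq0 : E6_scale != 0.
Proof. by apply: T_neq0 T_scale _; apply: oner_neq0. Qed.

Lemma E6_transfer_t i : T 0 (E6_t i) (tL i).
Proof.
rewrite -[tL i]divr1.
apply: (transfer_div (n := 0) (m := 1) E6_ev_kernel (oner_neq0 _) _ T_scale).
have [j ->|->] := unliftP ord0 i; first exact: T_beta.
suff <- : par_a tL (@Ordinal 3 2 isT) - par_a tL (@Ordinal 3 0 isT)
    = tL ord0 by apply: TB; apply: T_alpha.
by rewrite /par_a /= /alpha1 opprB addrC subrK.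
Qed.

Lemma E6_t0_neq0 : E6_t ord0 != 0.
Proof. exact: T_neq0 (E6_transfer_t ord0) t0L. Qed.

Lemma E6_t1_neq0 : 1 + E6_t ord0 != 0.
Proof.
apply: T_neq0 (TD _ (E6_transfer_t ord0)) t1L.
by rewrite -(rmorph1 cK) -(rmorph1 cL); apply: E6_transfer_const.
Qed.

(** Division by [E6_scale ^+ 2] and [E6_scale ^+ 3] moves the four points to one twist and makes the
    difference of the last two [alpha] equal to 1, so that [par_uniq] applies. *)
Lemma E6_param i : x i = E6_scale ^+ 2 * par_x (cK w) E6_t i /\
  y i = E6_scale ^+ 3 * par_y (cK w) E6_t i.
Proof.
have e0 := E6_scale_neq0; have [e2 e3] := (expf_neq0 2 e0, expf_neq0 3 e0).
pose x' i := x i / E6_scale ^+ 2; pose y' i := y i / E6_scale ^+ 3.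
have xB j : x' (lift ord0 j) - x' ord0 =
    (x (lift ord0 j) - x ord0) / E6_scale ^+ 2.
  by rewrite -mulrBl.
have xwB j : x' (lift ord0 j) - cK w * x' ord0 =
    (x (lift ord0 j) - cK w * x ord0) / E6_scale ^+ 2.
  by rewrite mulrA -mulrBl.
have x'B0 j : x' (lift ord0 j) - x' ord0 != 0.
  by rewrite xB mulf_neq0 ?invr_neq0 ?E6_xB_neq0.
have x'wB0 j : x' (lift ord0 j) - cK w * x' ord0 != 0.
  by rewrite xwB mulf_neq0 ?invr_neq0 ?E6_xwB_neq0.
have curve' j : y' j ^+ 2 - x' j ^+ 3 = - E6_scale ^- 6.
  rewrite /y' /x' !exprMn E6_curve -!exprVn -!exprM; ring.
have slE j : E6_slope j / E6_scale =
    slope_of (x' ord0) (y' ord0) (x' (lift ord0 j)) (y' (lift ord0 j)).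
  rewrite /slope_of xB /E6_slope /slope_of /y'.
  by field; rewrite e0 E6_xB_neq0.
have sl'E j : E6_slope' j / E6_scale =
    slope'_of (cK w) (x' ord0) (y' ord0) (x' (lift ord0 j)) (y' (lift ord0 j)).
  rewrite /slope'_of xwB /E6_slope' /slope'_of /y'.
  by field; rewrite e0 E6_xwB_neq0.
have alphaE j : E6_slope j / E6_scale + cK w ^+ 2 * (E6_slope' j / E6_scale) =
    E6_alpha j / E6_scale by rewrite mulrA -mulrDl.
have E := @par_uniq K (cK w) E6_t hwK n2K n3K E6_t0_neq0 E6_t1_neq0
  x' y' (fun j => E6_slope j / E6_scale) (fun j => E6_slope' j / E6_scale)
  _ x'B0 x'wB0 slE sl'E.
have {E} : x' =1 par_x (cK w) E6_t /\ y' =1 par_y (cK w) E6_t.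
  apply: E => [j|||j]; first by rewrite !curve'.
  - by rewrite !alphaE -mulrBl mulfV.
  - by rewrite !alphaE -mulrBl /E6_t unlift_none.
  - by rewrite /E6_t liftK mulrA -mulrDl.
by move=> [<- <-]; rewrite /x' /y' ![_ * (_ / _)]mulrC !divfK.
Qed.

(** The sixth power of the scale is thus a rational function of the [E6_t], which is the Kummer
    equation of the covering. *)
Lemma E6_scale6 : E6_scale ^+ 6 *
  (par_y0 (cK w) E6_t ^+ 2 - par_x0 (cK w) E6_t ^+ 3) = -1.
Proof.
have [xE yE] := E6_param ord0; have := E6_curve ord0.
rewrite xE yE par_x_0 par_y_0 => E.
transitivity ((E6_scale ^+ 3 * par_y0 (cK w) E6_t) ^+ 2 -
  (E6_scale ^+ 2 * par_x0 (cK w) E6_t) ^+ 3); first by ring.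
by rewrite E; ring.
Qed.

Section Action.
Variables (g : {rmorphism K -> K}) (hg : is_g6 w g).

Let w0 : cK w != 0 := w_neq0 hwK.

(** The numerator is multiplied by [-1] and the denominator by [w], whose inverse is [w ^+ 2]. *)
Lemma g6_slope j : g (E6_slope j) = - cK w ^+ 2 * E6_slope j.
Proof.
have x0 := E6_xB_neq0 j; have w2 := w2E hwK.
rewrite /E6_slope /slope_of fmorph_div rmorphD rmorphB !(g6_x hg) !(g6_y hg).
rewrite -mulrBr -opprD invfM mulNr mulrA.
have -> : (cK w)^-1 = cK w ^+ 2.
  by apply: (mulfI w0); rewrite mulfV //; ring: w2.
by ring.
Qed.

Lemma g6_slope' j : g (E6_slope' j) = - cK w ^+ 2 * E6_slope' j.
Proof.
have x0 := E6_xwB_neq0 j; have w2 := w2E hwK.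
rewrite /E6_slope' /slope'_of fmorph_div !rmorphB rmorphM !(g6_x hg) !(g6_y hg).
rewrite (g6_const hg) -mulrBr -opprD invfM mulNr mulrA.
have -> : (cK w)^-1 = cK w ^+ 2.
  by apply: (mulfI w0); rewrite mulfV //; ring: w2.
by ring.
Qed.

Lemma g6_alpha j : g (E6_alpha j) = - cK w ^+ 2 * E6_alpha j.
Proof.
by rewrite /E6_alpha rmorphD rmorphM rmorphXn (g6_const hg) g6_slope g6_slope'; ring.
Qed.

Lemma g6_beta j : g (E6_beta j) = - cK w ^+ 2 * E6_beta j.
Proof.
by rewrite /E6_beta rmorphD rmorphM (g6_const hg) g6_slope g6_slope'; ring.
Qed.

Lemma g6_scale : g E6_scale = - cK w ^+ 2 * E6_scale.
Proof. by rewrite /E6_scale rmorphB !g6_alpha -mulrBr. Qed.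

Lemma g6_t i : g (E6_t i) = E6_t i.
Proof.
have z0 : - cK w ^+ 2 != 0 by rewrite oppr_eq0 expf_neq0.
rewrite /E6_t fmorph_div g6_scale.
case: unliftP => [j _|_]; last rewrite rmorphB !g6_alpha -mulrBr.
  by rewrite g6_beta -mulf_div mulfV // mul1r.
by rewrite -mulf_div mulfV // mul1r.
Qed.

(** The square of this root of unity is [w] and its cube is [-1]; both differ from 1, which rules
    out the proper divisors of 6. *)
Lemma g6_root : 6.-primitive_root (- cK w ^+ 2).
Proof.
have w2 := w2E hwK; set z := - cK w ^+ 2.
have z6 : z ^+ 6 = 1 by rewrite /z; ring: w2.
have [//|m m_prim] := prim_order_exists _ z6.
have w1 : cK w != 1.
  by apply: contra_neq n3K => w1; rewrite -hwK w1; ring.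
have z3 : z ^+ 3 != 1.
  have -> : z ^+ 3 = -1 by rewrite /z; ring: w2.
  by rewrite -subr_eq0 -opprD oppr_eq0.
have z2 : z ^+ 2 != 1.
  by have -> : z ^+ 2 = cK w by rewrite /z; ring: w2.
move=> m6; have := m_prim; rewrite (_ : m = 6) //.
move: m6 z3 z2; rewrite -!(prim_order_dvd m_prim).
by case: m m_prim => [|[|[|[|[|[|[|m]]]]]]] // _ /dvdn_leq.
Qed.

End Action.
End E6Coordinates.

(** * Rings of fractions inside a field *)

Section FractionSubrings.
Variable K : fieldType.

Lemma mmap_subring (A : set K) (R : comNzRingType) n (f : {rmorphism R -> K})
    (h : 'I_n -> K) (q : {mpoly R[n]}) :
  is_subring A -> (forall c, A (f c)) -> (forall i, A (h i)) -> A (mmap f h q).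
Proof.
move=> subA Af Ah; elim/mpolyind: q => [|c m q _ _ IHq].
  by rewrite rmorph0; apply: subring0.
rewrite rmorphD -mul_mpolyC rmorphM; apply: subringD => //; apply: subringM => //.
  by have := Af c; rewrite -(mmapC h f c).
suff: A (mmap1 h m) by rewrite -(mmapX h f m).
rewrite /mmap1; apply: (big_ind (fun a => A a)) => [|a b|i _].
- by case: subA.
- exact: subringM.
- exact: subringX.
Qed.

(** The fractions allowed by the hypothesis of [localization_fractions]; being a subring, they can
    be checked on generators of [A]. *)
Definition unit_fractions (A0 A : set K) : set K :=
  [set z | exists b s, [/\ A0 b, A0 s, s != 0, A s^-1 & z = b / s]].

Section UnitFractions.
Variables A0 A : set K.
Hypotheses (subA0 : is_subring A0) (subA : is_subring A).

Lemma unit_fractions_sub : A0 `<=` unit_fractions A0 A.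
Proof.
move=> a A0a; exists a, 1; rewrite invr1 mulr1 oner_eq0.
by split=> //; [case: subA0|case: subA].
Qed.

Lemma unit_fractions_subring : is_subring (unit_fractions A0 A).
Proof.
split=> [|_ _ [a [s [Aa As s0 Ais ->]]] [b [t [Ab At t0 Ait ->]]]
         |_ _ [a [s [Aa As s0 Ais ->]]] [b [t [Ab At t0 Ait ->]]]].
- by apply: unit_fractions_sub; case: subA0.
- exists (a * t - b * s), (s * t); split.
  + by apply: subringD => //; [|apply: subringN => //]; apply: subringM.
  + exact: subringM.
  + exact: mulf_neq0.
  + by rewrite invfM; apply: subringM.
  + by field; rewrite s0 t0.
- exists (a * b), (s * t); split; try exact: subringM.
  + exact: mulf_neq0.
  + by rewrite invfM; apply: subringM.
  + by rewrite invfM mulrACA.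
Qed.

Lemma unit_fractionsV z : unit_fractions A0 A z -> z != 0 -> A z^-1 ->
  unit_fractions A0 A z^-1.
Proof.
move=> [a [s [Aa As s0 Ais ->]]]; rewrite mulf_eq0 negb_or => /andP[a0 _] Az.
exists s, a; split=> //; last by rewrite invf_div.
have -> : a^-1 = (a / s)^-1 * s^-1 by field; rewrite a0 s0.
exact: subringM.
Qed.

End UnitFractions.

Section LocalizedRange.
Variables (R : comNzRingType) (e : {rmorphism R -> K}).

Definition frac_range : set K :=
  [set f | exists a b, e b != 0 /\ f = e a / e b].

Definition localized_range (h : R) : set K :=
  [set f | exists a n, f = e a / e h ^+ n].

Lemma frac_range_relation : field_relation (fun z l => z = l /\ frac_range z).
Proof.
split=> [|a b c d [<- [a1 [a2 [a0 ->]]]] [<- [b1 [b2 [b0 ->]]]]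
  |a b c d [<- [a1 [a2 [a0 ->]]]] [<- [b1 [b2 [b0 ->]]]]
  |a b c d z0 [<- [a1 [a2 [a0 aE]]]] [bE [b1 [b2 [b0 bE']]]]].
- by split=> //; exists 1, 1; rewrite rmorph1 divr1 oner_eq0.
- split=> //; exists (a1 * b2 - b1 * a2), (a2 * b2).
  by rewrite rmorphB !rmorphM mulf_neq0 //; split=> //; field; rewrite a0 b0.
- split=> //; exists (a1 * b1), (a2 * b2).
  by rewrite !rmorphM mulf_neq0 //; split=> //; field; rewrite a0 b0.
- rewrite -bE bE' mulf_eq0 negb_or in z0; case/andP: z0 => b1_0 _.
  split; first by rewrite bE.
  exists (a1 * b2), (a2 * b1); rewrite !rmorphM mulf_neq0 //; split=> //.
  by rewrite aE bE'; field; rewrite a0 b0 b1_0.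
Qed.

Lemma frac_range_subring : is_subring frac_range.
Proof.
have relT := frac_range_relation; split=> [|a b Fa Fb|a b Fa Fb].
- by have [] := frel1 relT.
- by have [] := frelB relT (conj (erefl a) Fa) (conj (erefl b) Fb).
- by have [] := frelM relT (conj (erefl a) Fa) (conj (erefl b) Fb).
Qed.

Lemma frac_range_div a b : frac_range a -> frac_range b -> frac_range (a / b).
Proof.
move=> Fa Fb; have [->|b0] := eqVneq b 0.
  by rewrite invr0 mulr0; apply: subring0; apply: frac_range_subring.
by have [] := frel_div frac_range_relation b0 (conj (erefl a) Fa) (conj (erefl b) Fb).
Qed.

Lemma frac_range_sub a : frac_range (e a).
Proof. by exists a, 1; rewrite rmorph1 divr1 oner_eq0. Qed.

Lemma localized_range_sub h a : localized_range h (e a).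
Proof. by exists a, 0%N; rewrite expr0 divr1. Qed.

Lemma localized_range_inv h : localized_range h (e h)^-1.
Proof. by exists 1, 1%N; rewrite rmorph1 div1r. Qed.

Lemma localized_range_subring h : e h != 0 -> is_subring (localized_range h).
Proof.
move=> h0; split=> [|_ _ [a [n ->]] [b [m ->]]|_ _ [a [n ->]] [b [m ->]]].
- by rewrite -(rmorph1 e); apply: localized_range_sub.
- exists (a * h ^+ m - b * h ^+ n), (n + m)%N.
  rewrite rmorphB !rmorphM !rmorphXn exprD.
  by field; rewrite !expf_neq0.
- exists (a * b), (n + m)%N; rewrite rmorphM exprD.
  by field; rewrite !expf_neq0.
Qed.

Lemma common_denominator (zs : seq K) : (forall z, z \in zs -> frac_range z) ->
  exists2 h, e h != 0 & forall z, z \in zs -> localized_range h z.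
Proof.
elim: zs => [|z zs IHzs] frac_zs.
  by exists 1 => //; rewrite rmorph1 oner_eq0.
have [|h h0 loc_h] := IHzs.
  by move=> y zs_y; apply: frac_zs; rewrite inE zs_y orbT.
have [a [b [b0 zE]]] := frac_zs z (mem_head _ _).
exists (b * h); first by rewrite rmorphM mulf_neq0.
move=> y; rewrite inE => /predU1P[->|/loc_h[c [n ->]]].
  exists (a * h), 1%N; rewrite expr1 !rmorphM zE.
  by field; rewrite b0 h0.
exists (c * b ^+ n), n; rewrite !rmorphM rmorphXn exprMn.
by field; rewrite !expf_neq0.
Qed.

Lemma regular_localized_range h p : injective e -> regular_ring R ->
  e h != 0 -> is_prime (localized_range h) p ->
  regular (localization (localized_range h) p).
Proof.
move=> e_inj regR h0 primep.
have subB := localized_range_subring h0.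
have [||prime0 ->] := localization_fractions (range_subring e) subB _ primep.
- by move=> _ [a _ <-]; apply: localized_range_sub.
- move=> _ [a [n ->]]; exists (e a), (e h ^+ n); split=> //.
  + by exists (h ^+ n); rewrite ?rmorphXn.
  + exact: expf_neq0.
  + by rewrite -exprVn; apply: subringX => //; apply: localized_range_inv.
exact: regular_localization.
Qed.

End LocalizedRange.
End FractionSubrings.

(** * The invariant field and an affine chart of the quotient *)

Section Quotient.
Variables (k : fieldType) (w : k) (K : E6_power_field k 4).
Hypotheses (hw : w ^+ 2 + w + 1 = 0) (n2 : 2%:R != 0 :> k) (n3 : 3%:R != 0 :> k).
Variables (L : fieldType) (cL : {rmorphism k -> L}) (tL : 'I_4 -> L).
Hypotheses (t0L : tL ord0 != 0) (t1L : 1 + tL ord0 != 0).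
Hypotheses (xL : forall j, par_x (cL w) tL (lift ord0 j) - par_x0 (cL w) tL != 0)
  (wxL : forall j,
     par_x (cL w) tL (lift ord0 j) - cL w * par_x0 (cL w) tL != 0)
  (discL : par_y0 (cL w) tL ^+ 2 - par_x0 (cL w) tL ^+ 3 != 0).
Variables (g : {rmorphism K -> K}) (hg : is_g6 w g).
Variables (F : fieldType) (v : {rmorphism F -> K}) (cF : {rmorphism k -> F})
  (tF : 'I_4 -> F).
Hypotheses (gv : forall f, g (v f) = v f).
Hypotheses (vc : forall c, v (cF c) = E6_const K c)
  (vt : forall i, v (tF i) = E6_t w K i).

Local Notation cK := (E6_const K).
Local Notation x := (E6_x K).
Local Notation y := (E6_y K).
Local Notation e := (E6_scale w K).
Local Notation tK := (E6_t w K).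
Local Notation T := (transfer (E6_ev K) (univ_ev w cL tL) 0).

Let hwK : cK w ^+ 2 + cK w + 1 = 0.
Proof. by rewrite -rmorphXn -rmorphD -(rmorph1 cK) -rmorphD hw rmorph0. Qed.
Let n2K : 2%:R != 0 :> K. Proof. by rewrite -(rmorph_nat cK) fmorph_eq0. Qed.
Let n3K : 3%:R != 0 :> K. Proof. by rewrite -(rmorph_nat cK) fmorph_eq0. Qed.
Let n6K : 6%:R != 0 :> K. Proof. by rewrite (natrM K 2 3) mulf_neq0. Qed.

Let kerP : monomial_kernel (E6_ev K) (univ_ev w cL tL).
Proof. exact: E6_ev_kernel. Qed.
Let relT : field_relation T := transfer_field kerP.
Let T_const c : T (cK c) (cL c). Proof. exact: E6_transfer_const. Qed.
Let T_t i : T (tK i) (tL i). Proof. exact: E6_transfer_t. Qed.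
Let e0 : e != 0.
Proof. exact: (E6_scale_neq0 K hw n2 n3 t0L t1L xL wxL discL). Qed.
Let xE i : x i = e ^+ 2 * par_x (cK w) tK i.
Proof. by have [] := E6_param K hw n2 n3 t0L t1L xL wxL discL i. Qed.
Let yE i : y i = e ^+ 3 * par_y (cK w) tK i.
Proof. by have [] := E6_param K hw n2 n3 t0L t1L xL wxL discL i. Qed.
Let tK0 : tK ord0 != 0.
Proof. exact: (E6_t0_neq0 K hw n2 n3 t0L t1L xL wxL discL). Qed.
Let tK1 : 1 + tK ord0 != 0.
Proof. exact: (E6_t1_neq0 K hw n2 n3 t0L t1L xL wxL discL). Qed.
Let xB0 j : x (lift ord0 j) - x ord0 != 0.
Proof. exact: (E6_xB_neq0 K hw n2 n3 t0L t1L xL discL). Qed.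
Let xwB0 j : x (lift ord0 j) - cK w * x ord0 != 0.
Proof. exact: (E6_xwB_neq0 K hw n2 n3 t0L t1L wxL discL). Qed.
Let disc6 : e ^+ 6 * (par_y0 (cK w) tK ^+ 2 - par_x0 (cK w) tK ^+ 3) = -1.
Proof. exact: (E6_scale6 K hw n2 n3 t0L t1L xL wxL discL). Qed.

Definition quot_ev : {rmorphism {mpoly k[4]} -> F} := mmap cF tF.
Definition param_ev : {rmorphism {mpoly k[4]} -> L} := mmap cL tL.

Lemma quot_evC c : quot_ev c%:MP = cF c.
Proof. exact: (mmapC tF cF c). Qed.

Lemma quot_evX i : quot_ev 'X_i = tF i.
Proof. by rewrite /quot_ev /= mmapX mmap1U. Qed.

Lemma quot_evE q : v (quot_ev q) = mmap cK tK q.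
Proof.
apply: (@mpoly_rmorph_ext _ _ _ (v \o quot_ev) (mmap cK tK)) => [c|i] /=.
  by rewrite (mmapC tF cF c) (mmapC tK cK c) vc.
by rewrite !mmapX !mmap1U vt.
Qed.

Lemma quot_ev_transfer q : T (v (quot_ev q)) (param_ev q).
Proof.
elim/mpolyind: q => [|c m q _ _ IHq]; first by rewrite !rmorph0; apply: (frel0 relT).
rewrite !rmorphD -mul_mpolyC; apply: (frelD relT) => //.
rewrite !rmorphM; apply: (frelM relT).
  rewrite quot_evC vc (_ : param_ev _ = cL c); first exact: T_const.
  exact: (mmapC tL cL c).
rewrite mpolyXE_id !rmorph_prod.
apply: (big_ind2 T) => [|a b c' d|i _]; first exact: (frel1 relT).
  exact: (frelM relT).
rewrite !rmorphXn; apply: (frelX relT); rewrite quot_evX vt.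
by rewrite /param_ev /= mmapX mmap1U; apply: T_t.
Qed.

Hypothesis param_inj : injective param_ev.

(** The coordinates [tF] are algebraically independent because their transfers [tL] are: one element
    of [K] has only one transfer. *)
Lemma quot_ev_inj : injective quot_ev.
Proof.
move=> p q pq; apply: param_inj; apply: (transfer_uniq kerP (quot_ev_transfer p)).
by rewrite pq; apply: quot_ev_transfer.
Qed.

Let Fr : set F := frac_range quot_ev.
Let subFr : is_subring Fr := frac_range_subring quot_ev.

(** The diagonal of the subfield generated by the coordinates. With this relation [frel_x] and
    [frel_y] place the parametrized points in that subfield. *)
Let TK (z l : K) := z = l /\ exists2 f, Fr f & v f = z.

Let relTK : field_relation TK.
Proof.
split=> [|a b c d [<- [f Ff fE]] [<- [h Fh hE]]|a b c d [<- [f Ff fE]] [<- [h Fh hE]]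
  |a b c d d0 [<- [f Ff fE]] [<- [h Fh hE]]].
- by split=> //; exists 1; rewrite ?rmorph1 //; case: subFr.
- by split=> //; exists (f - h); rewrite ?rmorphB ?fE ?hE //; case: subFr => _ + _; apply.
- by split=> //; exists (f * h); rewrite ?rmorphM ?fE ?hE //; apply: subringM.
- by split=> //; exists (f / h); rewrite ?fmorph_div ?fE ?hE //; apply: frac_range_div.
Qed.

Let TK_c c : TK (cK c) (cK c).
Proof.
split=> //; exists (cF c); last exact: vc.
by rewrite -quot_evC; apply: frac_range_sub.
Qed.

Let TK_t i : TK (tK i) (tK i).
Proof.
split=> //; exists (tF i); last exact: vt.
by rewrite -quot_evX; apply: frac_range_sub.
Qed.

Let xi_ex i : exists2 f, Fr f & v f = par_x (cK w) tK i.
Proof. by have [] := frel_x relTK (TK_c w) TK_t hwK n3K tK0 tK1 i. Qed.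

Let eta_ex i : exists2 f, Fr f & v f = par_y (cK w) tK i.
Proof. by have [] := frel_y relTK (TK_c w) TK_t hwK n2K n3K tK0 tK1 i. Qed.

Let xi i : F := s2val (cid2 (xi_ex i)).
Let eta i : F := s2val (cid2 (eta_ex i)).
Let Fr_xi i : Fr (xi i). Proof. exact: (s2valP (cid2 (xi_ex i))). Qed.
Let Fr_eta i : Fr (eta i). Proof. exact: (s2valP (cid2 (eta_ex i))). Qed.
Let xiE i : x i = v (xi i) * e ^+ 2.
Proof. by rewrite xE /xi (s2valP' (cid2 (xi_ex i))) mulrC. Qed.
Let etaE i : y i = v (eta i) * e ^+ 3.
Proof. by rewrite yE /eta (s2valP' (cid2 (eta_ex i))) mulrC. Qed.
Let c6 : F := - (eta ord0 ^+ 2 - xi ord0 ^+ 3)^-1.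

Let c6E : v c6 = e ^+ 6.
Proof.
rewrite rmorphN fmorphV rmorphB !rmorphXn.
rewrite /xi /eta (s2valP' (cid2 (xi_ex ord0))) (s2valP' (cid2 (eta_ex ord0))).
rewrite par_x_0 par_y_0 -mulN1r -disc6; set D := _ - _.
rewrite mulfK //; apply/eqP => D0; move: disc6; rewrite -/D D0 mulr0 => /eqP.
by rewrite eq_sym oppr_eq0 oner_eq0.
Qed.

Let Fr_c6 : Fr c6 /\ Fr c6^-1.
Proof.
have FD : Fr (eta ord0 ^+ 2 - xi ord0 ^+ 3).
  by case: (subFr) => _ + _; apply; apply: subringX.
have Fr6 : Fr c6.
  apply: subringN => //; rewrite -div1r; apply: frac_range_div => //.
  by case: subFr.
by split=> //; rewrite -div1r; apply: frac_range_div => //; case: subFr.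
Qed.

Let z : K := - cK w ^+ 2.
Let z_prim : 6.-primitive_root z := g6_root K hw n2 n3.
Let gz : g z = z. Proof. by rewrite rmorphN rmorphXn (g6_const hg). Qed.
Let ge : g e = z * e := g6_scale hw n2 n3 t0L t1L xL wxL discL hg.

Let span (B : set F) := @kummer_span F K v 5 e B.

Lemma E6_ev_span B : is_subring B -> B c6 -> B c6^-1 -> (forall c, B (cF c)) ->
  (forall i, B (xi i)) -> (forall i, B (eta i)) -> forall q, span B (E6_ev K q).
Proof.
move=> subB Bc6 Bc6V BcF Bxi Beta q.
have sub := kummer_span_subring subB c6E Bc6 (n' := 5).
have span_v f : B f -> span B (v f) :=
  @kummer_span_sub F K v 5 e B c6 subB c6E Bc6 f.
have span_e : span B e := kummer_span_gen subB c6E Bc6.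
apply: mmap_subring => // [c|j].
  by rewrite -vc; apply: span_v.
rewrite /E6_coord; case: split => i.
  by rewrite xiE; apply: subringM => //; [apply: span_v|apply: subringX].
by rewrite etaE; apply: subringM => //; [apply: span_v|apply: subringX].
Qed.

(** An invariant is a quotient of polynomials in the [x i] and [y i]. These lie in the span of the
    powers of [e] over [Fr], and [kummer_fractions] descends the quotient to [Fr]. *)
Lemma quot_ev_fractions f : frac_range quot_ev f.
Proof.
have [Fc6 Fc6V] := Fr_c6.
have FcF c : Fr (cF c) by rewrite -quot_evC; apply: frac_range_sub.
have span_ev q := E6_ev_span subFr Fc6 Fc6V FcF Fr_xi Fr_eta q.
have [p [q [q0 fE]]] := E6_fractions (v f).
have [a [b [Fa Fb b0 ->]]] := kummer_fractions n6K z_prim gv gz ge e0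
  (span_ev p) (span_ev q) q0 fE.
exact: frac_range_div.
Qed.

(** The transfer is a total relation on [F] by [quot_ev_fractions] and single-valued by
    [transfer_uniq], hence the graph of a morphism: the comorphism of the rational map. *)
Lemma quot_param : exists phi : {rmorphism F -> L},
  forall q, phi (quot_ev q) = param_ev q.
Proof.
have [||f l l'|phi phiE] := @rmorphism_of_relation F L (fun f l => T (v f) l).
- split=> [|a b c d|a b c d|a b c d].
  + by rewrite rmorph1; apply: (frel1 relT).
  + by rewrite rmorphB; apply: (frelB relT).
  + by rewrite rmorphM; apply: (frelM relT).
  + by rewrite fmorph_div; apply: (frel_div relT).
- move=> f; have [a [b [b0 ->]]] := quot_ev_fractions f.
  exists (param_ev a / param_ev b); rewrite fmorph_div.
  apply: (frel_div relT); [|exact: quot_ev_transfer|exact: quot_ev_transfer].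
  apply: contra_neq b0 => b0; suff -> : b = 0 by rewrite rmorph0.
  by apply: param_inj; rewrite b0 rmorph0.
- exact: (transfer_uniq kerP).
by exists phi => q; apply: (transfer_uniq kerP (phiE _)); apply: quot_ev_transfer.
Qed.

Lemma quot_chart : exists2 h, quot_ev h != 0 &
  forall p, is_prime (localized_range quot_ev h) p ->
    exists2 O, points (E6_power K) O &
      [set f | O (v f)] = localization (localized_range quot_ev h) p.
Proof.
pose dx j := (xi (lift ord0 j) - xi ord0)^-1.
pose dwx j := (xi (lift ord0 j) - cF w * xi ord0)^-1.
(* [c6] and its inverse make [e] a unit of the cover [A], [xi] and [eta] put the affine coordinates
   of E(6)^4 in [A], and [dx] and [dwx] make the denominators of the slopes units of [A]. *)
pose zs := [:: c6; c6^-1] ++ codom xi ++ codom eta ++ codom dx ++ codom dwx.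
have [|h h0 loc_h] := @common_denominator F _ quot_ev zs.
  by move=> f _; apply: quot_ev_fractions.
exists h => // p primep; set B := localized_range quot_ev h in primep *.
have subB : is_subring B := localized_range_subring h0.
have Bc6 : B c6 by apply: loc_h; rewrite !inE eqxx.
have Bc6V : B c6^-1 by apply: loc_h; rewrite !inE eqxx orbT.
have Bxi i : B (xi i) by apply: loc_h; rewrite !mem_cat codom_f !orbT.
have Beta i : B (eta i) by apply: loc_h; rewrite !mem_cat codom_f !orbT.
have Bdx j : B (dx j) by apply: loc_h; rewrite !mem_cat codom_f !orbT.
have Bdwx j : B (dwx j) by apply: loc_h; rewrite !mem_cat codom_f !orbT.
have BcF c : B (cF c) by rewrite -quot_evC; apply: localized_range_sub.
pose A := span B.
have subA : is_subring A := kummer_span_subring subB c6E Bc6.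
have sub_A f : B f -> A (v f) := @kummer_span_sub F K v 5 e B c6 subB c6E Bc6 f.
have Ae : A e := kummer_span_gen subB c6E Bc6.
have AeV : A e^-1 := kummer_span_genV e0 subB c6E Bc6 Bc6V.
have Ac c : A (cK c) by rewrite -vc; apply: sub_A.
have Ax i : A (x i).
  by rewrite xiE; apply: subringM => //; [apply: sub_A|apply: subringX].
have Ay i : A (y i).
  by rewrite etaE; apply: subringM => //; [apply: sub_A|apply: subringX].
have AxV j : A (x (lift ord0 j) - x ord0)^-1.
  rewrite !xiE -mulrBl -rmorphB invfM -fmorphV -exprVn.
  apply: (subringM subA); [exact: sub_A (Bdx j)|exact: subringX].
have AxwV j : A (x (lift ord0 j) - cK w * x ord0)^-1.
  rewrite !xiE mulrA -vc -rmorphM -mulrBl -rmorphB invfM -fmorphV -exprVn.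
  apply: (subringM subA); [exact: sub_A (Bdwx j)|exact: subringX].
pose coord (i : 'I_4) (j : 'I_3) : K := nth 0 [:: x i; y i; 1] j.
(* The chart where [z] is nonzero in every factor; [A0] is its coordinate ring. *)
pose z_coord (i : 'I_4) : 'I_3 := ord_max.
have z1 i : coord i (z_coord i) = 1 by [].
pose A0 := gen_ring (range cK `|`
  [set f | exists i j, f = coord i j / coord i (z_coord i)]).
have subA0 : is_subring A0 by apply: gen_ring_subring.
have A0c c : A0 (cK c) by apply: gen_ring_sub; left; exists c.
have A0x i : A0 (x i).
  by apply: gen_ring_sub; right; exists i, ord0; rewrite z1 divr1.
have A0y i : A0 (y i).
  by apply: gen_ring_sub; right; exists i, (@Ordinal 3 1 isT); rewrite z1 divr1.
have A0A : A0 `<=` A.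
  apply: gen_ring_min => // _ [[c _ <-]//|[i [j ->]]].
  rewrite z1 divr1; elim/ord3_ind: j; [exact: Ax|exact: Ay|].
  by case: (subA).
(* The aim is [A] inside [A1]: the slopes, the scale, the [tK i] and finally the inverse of [h] are
   fractions of [A0] with denominators invertible in [A]. Local rings of [A] are then local rings of
   the chart. *)
pose A1 := unit_fractions A0 A.
have subA1 : is_subring A1 by apply: unit_fractions_subring.
have A01 : A0 `<=` A1 by apply: unit_fractions_sub.
have A1c c : A1 (cK c) by apply: A01.
have A1B a b : A1 a -> A1 b -> A1 (a - b) by case: subA1 => _ + _; apply.
have A1x j : A1 (x (lift ord0 j) - x ord0) by apply: A1B; apply: A01.
have A1xw j : A1 (x (lift ord0 j) - cK w * x ord0).
  by apply: A1B; [|apply: subringM => //]; apply: A01.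
have A1sl j : A1 (E6_slope K j).
  apply: subringM => //; first by apply: subringD => //; apply: A01.
  exact: (unit_fractionsV subA (A1x j) (xB0 j) (AxV j)).
have A1sl' j : A1 (E6_slope' w K j).
  apply: subringM => //; first by apply: A1B; apply: A01.
  exact: (unit_fractionsV subA (A1xw j) (xwB0 j) (AxwV j)).
have A1al j : A1 (E6_alpha w K j).
  by apply: subringD => //; apply: subringM => //; apply: subringX.
have A1be j : A1 (E6_beta w K j).
  by apply: subringD => //; apply: subringM.
have A1e : A1 e by apply: A1B.
have A1eV : A1 e^-1 by apply: unit_fractionsV.
have A1t i : A1 (tK i).
  by apply: subringM => //; case: unliftP => [j _|_] //; apply: A1B.
have A1ev q : A1 (v (quot_ev q)) by rewrite quot_evE; apply: mmap_subring.
have A1B' f : B f -> A1 (v f).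
  move=> [a [n ->]]; rewrite fmorph_div rmorphXn -exprVn.
  apply: subringM => //; apply: subringX => //.
  have vh0 : v (quot_ev h) != 0 by rewrite (fmorph_eq0 v).
  apply: (unit_fractionsV subA (A1ev h) vh0).
  by rewrite -fmorphV; apply: sub_A; apply: localized_range_inv.
have AA1 : A `<=` A1.
  move=> _ [b Bb ->]; apply: subring_sum => // i _.
  by apply: subringM => //; [apply: A1B'|apply: subringX].
have [P primeP PE] := kummer_local_ring n6K z_prim gv gz ge e0 subB c6E Bc6 primep.
have [primeP0 locE] := localization_fractions subA0 subA A0A primeP AA1.
exists (localization A P) => //; rewrite locE.
exists z_coord.
  by move=> i; rewrite -[nth _ _ _]/(coord i (z_coord i)) z1 oner_eq0.
by exists (P `&` A0).
Qed.

End Quotient.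

(** * The rational map *)

Lemma zero_prime (K : fieldType) (A : set K) :
  is_subring A -> is_prime A [set 0].
Proof.
move=> subA; split=> [_ ->||a _ _ ->|/eqP|a b _ _ /= /eqP].
- exact: subring0.
- by split=> // _ _ -> ->; rewrite addr0.
- by rewrite mulr0.
- by rewrite oner_eq0.
- by rewrite mulf_eq0 => /orP[/eqP|/eqP]; [left|right].
Qed.

Lemma prime_preim_sub (K L : fieldType) (phi : {rmorphism K -> L})
    (B : set K) (O q : set L) : is_subring B -> is_prime O q ->
  (forall b, B b -> O (phi b)) -> is_prime B (B `&` phi @^-1` q).
Proof.
move=> subB [qO [q0 qD] qM q1 qP] BO; split=> [a []//||a b Ba [Bb qb]||a b Ba Bb].
- split; first by split; [apply: subring0|rewrite /preimage /= rmorph0].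
  move=> a b [Ba qa] [Bb qb]; split; first exact: subringD.
  by rewrite /preimage /= rmorphD; apply: qD.
- split; first exact: subringM.
  by rewrite /preimage /= rmorphM; apply: qM => //; apply: BO.
- by case=> _; rewrite /preimage /= rmorph1.
- case=> _; rewrite /preimage /= rmorphM => /(qP _ _ (BO _ Ba) (BO _ Bb)).
  by case; [left|right].
Qed.

(** The image of the point [O] is its centre on [Spec B]: elements of [B] outside [p] become units
    of [O]. *)
Lemma localization_local_morphism (K L : fieldType) (phi : {rmorphism K -> L})
    (B : set K) (A q : set L) (O := localization A q)
    (p := B `&` phi @^-1` (max_ideal O)) :
  is_subring B -> is_subring A -> is_prime A q ->
  (forall b, B b -> O (phi b)) ->
  [/\ is_prime B p, forall f, localization B p f -> O (phi f) &
      forall f, max_ideal (localization B p) f -> max_ideal O (phi f)].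
Proof.
move=> subB subA primeq BO.
have subO : is_subring O := localization_subring subA primeq.
have primeO : is_prime O (max_ideal O) := max_ideal_prime subA primeq.
have primep : is_prime B p := prime_preim_sub subB primeO BO.
have unitO s : B s -> ~ p s -> O (phi s)^-1.
  move=> Bs ps; apply: contrapT => nO; apply: ps; split=> //.
  by split; [apply: BO|right].
split=> // f.
  move=> [a [s [Ba Bs ps ->]]]; rewrite fmorph_div.
  by apply: subringM => //; [apply: BO|apply: unitO].
rewrite max_ideal_localization // => -[a [s [[Ba pa] Bs ps ->]]].
rewrite fmorph_div mulrC; case: primeO => _ _ + _ _; apply => //.
exact: unitO.
Qed.

Lemma prim3_eq0 (k : fieldType) (w : k) :
  3.-primitive_root w -> w ^+ 2 + w + 1 = 0.
Proof.
move=> hw; have w1 : w - 1 != 0.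
  by rewrite subr_eq0; have := prim_order_dvd hw 1; rewrite expr1 => <-.
apply: (mulfI w1); rewrite mulr0; transitivity (w ^+ 3 - 1); first by ring.
by rewrite (prim_expr_order hw) subrr.
Qed.

Lemma pchar_natf_neq0 (k : fieldType) p : prime p -> p \notin [pchar k] ->
  p%:R != 0 :> k.
Proof. by move=> pr; rewrite inE pr. Qed.

Lemma univ_param_ev (k : fieldType) (q : {mpoly k[4]}) :
  param_ev (univ_const k) (@univ_t k) q = tofrac q.
Proof.
apply: (@mpoly_rmorph_ext _ _ _ (param_ev (univ_const k) (@univ_t k))
  (@tofrac _)) => [c|i].
  exact: (mmapC _ (univ_const k) c).
by rewrite /param_ev /= mmapX mmap1U.
Qed.

Lemma univ_param_inj (k : fieldType) :
  injective (param_ev (univ_const k) (@univ_t k)).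
Proof.
by move=> p q; rewrite !univ_param_ev => /eqP; rewrite tofrac_eq => /eqP.
Qed.

Theorem theorem1p2 (k : fieldType)
    (char_neq2 : 2%N \notin [pchar k]%R) (char_neq3 : 3%N \notin [pchar k]%R)
    (w : k) (hw : (3.-primitive_root w)%R)
    (K : E6_power_field k 4) (g : {rmorphism K -> K}) (hg : is_g6 w g) :
  unirational_from 4 (X6 hg).
Proof.
have w2 := prim3_eq0 hw.
have n2 := pchar_natf_neq0 (isT : prime 2) char_neq2.
have n3 := pchar_natf_neq0 (isT : prime 3) char_neq3.
have t0 := univ_t0_neq0 k; have t1 := univ_t1_neq0 n2.
have xL := univ_x_neq0 w2 n2 n3; have wxL := univ_wx_neq0 w2 n2 n3.
have discL := univ_disc_neq0 w2 n2 n3.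
have gt i : E6_t w K i \in fixed g.
  by apply/eqP; apply: (g6_t w2 n2 n3 t0 t1 xL wxL discL hg).
pose F : fieldType := fixed_field g.
pose v : {rmorphism F -> K} := \val.
pose cF : {rmorphism k -> F} := fixed_const (g6_const hg).
pose tF i : F := FixedField (gt i).
have gv f : g (v f) = v f by apply/eqP/(fixed_valP f).
have vc c : v (cF c) = E6_const K c by [].
have vt i : v (tF i) = E6_t w K i by [].
have [phi phiE] := quot_param w2 n2 n3 t0 t1 xL wxL discL hg gv vc vt
  (@univ_param_inj k).
have [h h0 chart] := quot_chart w2 n2 n3 t0 t1 xL wxL discL hg gv vc vt.
have ev_inj : injective (quot_ev cF tF) :=
  quot_ev_inj w2 n2 n3 t0 t1 xL wxL discL vc vt (@univ_param_inj k).
have phi_ev q : phi (quot_ev cF tF q) = tofrac q by rewrite phiE univ_param_ev.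
set B := localized_range (quot_ev cF tF) h in chart.
have subB : is_subring B by apply: localized_range_subring.
have regB p : is_prime B p -> regular (localization B p).
  by apply: regular_localized_range => //; apply: regular_mpoly.
(* Regularity of these functions at a point of projective space forces all of [B] to map into its
   local ring; they define the principal open set [h != 0] of affine space. *)
pose Fl : seq {fraction {mpoly k[4]}} := (tofrac h)^-1 :: codom (@univ_t k).
have phiB O : is_subring O -> (forall c, O (univ_const k c)) ->
    (forall f, f \in Fl -> O f) -> forall b, B b -> O (phi b).
  move=> subO Oc OFl _ [a [n ->]]; rewrite fmorph_div rmorphXn !phi_ev -exprVn.
  apply: subringM => //; last first.
    by apply: subringX => //; apply: OFl; rewrite mem_head.
  rewrite -univ_param_ev; apply: mmap_subring => // i; apply: OFl.
  by rewrite inE codom_f orbT.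
exists phi; split.
  move=> c; rewrite -[const _ c]/(cF c) -(quot_evC cF tF) phi_ev.
  by [].
exists [set O | points (proj_space k 4) O /\ forall f, f \in Fl -> O f]; split.
- split=> [O []//|O [PO OFl]]; exists Fl.
  by split=> [|Q PQ QFl]; [exact: OFl|exact: (conj PQ QFl)].
- pose hc (u : unit) (j : 'I_5) : {fraction {mpoly k[4]}} :=
    if unlift ord0 j is Some i then @tofrac {mpoly k[4]} 'X_i else 1.
  have hc0 u : hc u ord0 = 1 by rewrite /hc unlift_none.
  pose A := gen_ring (range (univ_const k) `|`
    [set f | exists u j, f = hc u j / hc u ord0]).
  have subA : is_subring A by apply: gen_ring_subring.
  have prime0 := zero_prime subA.
  have Ac c : A (univ_const k c) by apply: gen_ring_sub; left; exists c.
  have At i : A (univ_t k i).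
    apply: gen_ring_sub; right; exists tt, (lift ord0 i).
    by rewrite hc0 divr1 /hc liftK.
  (* The generic point shows that the open set is nonempty. *)
  exists (localization A [set 0]); split.
    exists (fun=> ord0).
      by move=> u; rewrite -[X in X != 0]/(hc u ord0) hc0 oner_eq0.
    by exists [set 0].
  move=> f; rewrite inE => /predU1P[->|/codomP[i ->]].
    apply: localization_inv => //.
      by rewrite -univ_param_ev; apply: mmap_subring.
    apply/eqP; rewrite tofrac_eq0; apply: contra_neq h0 => ->; exact: rmorph0.
  exact: localization_sub.
- move=> _ [[c c0 [p primep ->]] OFl].
  set A := gen_ring _ in primep OFl *.
  have subA : is_subring A by apply: gen_ring_subring.
  have Ac a : A (univ_const k a) by apply: gen_ring_sub; left; exists a.
  have subO := localization_subring subA primep.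
  have BO := phiB _ subO (fun a => localization_sub subA primep (Ac a)) OFl.
  have [primeB QO mQO] := localization_local_morphism subB subA primep BO.
  exists (localization B (B `&` phi @^-1` max_ideal (localization A p))); split=> //.
  (* The image is a regular point of the quotient, hence outside the centre of the blow-up. *)
  left; split; last by case=> _ []; apply: regB.
  have [O PO OE] := chart _ primeB.
  by exists O.
Qed.
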